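(* Let $u(x)$ be a Gaussian random function with law $\mu_0$ and covariance $\mathrm{Cov}[u(x),u(y)]=a^{-1}(x,y)$. Let $g_1,\dots,g_N$ be kernels and let $U_\alpha[u(\cdot)]=\int g_\alpha(x)u(x)\,dx$ for $\alpha=1,\dots,N$, with the $N\times N$ matrix of entries $\mathrm{Cov}[U_\beta[u(\cdot)],U_\alpha[u(\cdot)]]$ invertible. Let $V=(V_1,\dots,V_N)^T\in\mathbb{R}^N$, and let $\langle\cdot\rangle_V$ and $\mathrm{Cov}[\cdot,\cdot]_V$ denote expectation and covariance with respect to the law of $u$ conditioned on $U_\alpha[u(\cdot)]=V_\alpha$, $\alpha=1,\dots,N$. Then Wick's theorem holds for conditional expectations: for every $l\ge 1$ and all (not necessarily distinct) indices $i_1,\dots,i_l$, with $u_i=u(x_i)$ denoting the value of $u$ at a point $x_i$, $$\big\langle (u_{i_1}-\langle u_{i_1}\rangle_V)\cdots(u_{i_l}-\langle u_{i_l}\rangle_V)\big\rangle_V=\begin{cases}0, & l\ \text{odd},\\[4pt] \displaystyle\sum \mathrm{Cov}[u_{i_{p_1}},u_{i_{p_2}}]_V\cdots\mathrm{Cov}[u_{i_{p_{l-1}}},u_{i_{p_l}}]_V, & l\ \text{even},\end{cases}$$ where the sum is over all possible pairings $\{\{p_1,p_2\},\dots,\{p_{l-1},p_l\}\}$ of the positions $\{1,\dots,l\}$, i.e. over all pairings of $\{i_1,\dots,i_l\}$.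
   Context: A random real-valued function $u(x)$ is Gaussian with law $\mu_0$ if it has (formal) probability density $$f_0[u(\cdot)]=Z^{-1}\exp\Big(-\tfrac12\iint u(x)a(x,y)u(y)\,dx\,dy+\int b(x)u(x)\,dx\Big),$$ with $a(x,y)$, $b(x)$ (generalized) functions and $Z$ a normalizing constant. Averages with respect to $\mu_0$ are denoted $\langle\cdot\rangle$. The mean and covariance are $\langle u(x)\rangle=\int a^{-1}(x,y)b(y)\,dy$ and $$\mathrm{Cov}[u(x),u(y)]=\langle u(x)u(y)\rangle-\langle u(x)\rangle\langle u(y)\rangle=a^{-1}(x,y),$$ where $a^{-1}$ is the integral-kernel inverse of $a$, defined by $\int a(x,z)a^{-1}(z,y)\,dz=\int a^{-1}(x,z)a(z,y)\,dz=\delta(x-y)$. The kernels $g_\alpha$ are (generalized) functions such that the integrals written are meaningful. The linear functionals $U_\alpha[u(\cdot)]=\int g_\alpha(x)u(x)\,dx$ (called collective variables) are then jointly Gaussian together with the values $u(x)$, and $\mathrm{Cov}[u(x),U_\alpha]=\int a^{-1}(x,y)g_\alpha(y)\,dy$. For $V\in\mathbb{R}^N$, the conditional measure $\mu_V$ is the prior conditioned on $U_\alpha[u(\cdot)]=V_\alpha$ for all $\alpha$. Formally it has density $f_V[u(\cdot)]=c\,f_0[u(\cdot)]\prod_{\alpha=1}^N\delta(U_\alpha[u(\cdot)]-V_\alpha)$ with $c$ a normalization factor. Averages with respect to $\mu_V$ are denoted $\langle\cdot\rangle_V$; equivalently, $\langle O\rangle_V$ is the value at $V$ of the version, continuous in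 $V$, of the conditional expectation of $O[u(\cdot)]$ given $(U_1,\dots,U_N)=V$. The conditional covariance is $\mathrm{Cov}[A,B]_V=\langle AB\rangle_V-\langle A\rangle_V\langle B\rangle_V$. *)

(* Defs.v *)
From HB Require Import structures.
From mathcomp Require Import all_boot all_order all_algebra.
From mathcomp Require Import all_classical all_reals all_analysis.
Import Order.TTheory GRing.Theory Num.Theory.
Import numFieldNormedType.Exports.

Set Implicit Arguments.
Unset Strict Implicit.
Unset Printing Implicit Defensive.

Local Open Scope classical_set_scope.
Local Open Scope ring_scope.

(* A generalized function g on X is given by its pairing f |-> \int g(x) f(x) dx,
   a linear functional on the space [gdom g] of those functions f for which this
   integral is meaningful.  Ordinary functions and Dirac functions are the
   instances [gfun_fun] and [gfun_dirac] below. *)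
Record gfun (X : Type) (R : realType) := GFun {
  gdom : set (X -> R) ;
  gpair : (X -> R) -> R ;
  gdom0 : gdom (fun=> 0) ;
  gdomP : forall (c : R) f h, gdom f -> gdom h ->
    gdom (fun x => c * f x + h x) ;
  gpairP : forall (c : R) f h, gdom f -> gdom h ->
    gpair (fun x => c * f x + h x) = c * gpair f + gpair h }.

(* A generalized kernel a(x, y), likewise given by the bilinear form
   (f, h) |-> \int\int f(x) a(x, y) h(y) dx dy on a space [kdom a]. *)
Record gkernel (X : Type) (R : realType) := GKernel {
  kdom : set (X -> R) ;
  kform : (X -> R) -> (X -> R) -> R ;
  kdom0 : kdom (fun=> 0) ;
  kdomP : forall (c : R) f h, kdom f -> kdom h ->
    kdom (fun x => c * f x + h x) ;
  kformPl : forall (c : R) f h k, kdom f -> kdom h -> kdom k ->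
    kform (fun x => c * f x + h x) k = c * kform f k + kform h k ;
  kformPr : forall (c : R) f h k, kdom f -> kdom h -> kdom k ->
    kform k (fun x => c * f x + h x) = c * kform k f + kform k h }.

Section gfun_fun.
Context d (X : measurableType d) (R : realType).
Variables (mu : {measure set X -> \bar R}) (g : X -> R).

Let dom : set (X -> R) :=
  [set f | mu.-integrable setT (EFin \o (fun x => g x * f x))].
Let pair (f : X -> R) : R := \int[mu]_x (g x * f x).

Let mulE (c : R) (f h : X -> R) :
  (fun x => g x * (c * f x + h x)) = (fun x => c * (g x * f x) + g x * h x).
Proof. by apply/funext => x; rewrite mulrDr mulrCA. Qed.

Let dom0 : dom (fun=> 0).
Proof.
rewrite /dom/= (_ : EFin \o _ = cst 0%E); first exact: integrable0.
by apply/funext => x /=; rewrite mulr0.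
Qed.

Let domZ (c : R) f : dom f ->
  mu.-integrable setT (EFin \o (fun x => c * (g x * f x))).
Proof.
move=> df; rewrite (_ : EFin \o _ = (fun x => (c%:E * (g x * f x)%:E)%E)).
  exact: integrableZl.
by apply/funext => x /=; rewrite EFinM.
Qed.

Let domP (c : R) f h : dom f -> dom h -> dom (fun x => c * f x + h x).
Proof.
move=> df dh; rewrite /dom/= mulE.
rewrite (_ : EFin \o _ =
  ((EFin \o (fun x => (c * (g x * f x))%R)) \+ (EFin \o (fun x => (g x * h x)%R)))%E) //.
exact: integrableD (domZ c df) dh.
Qed.

Let pairP (c : R) f h : dom f -> dom h ->
  pair (fun x => c * f x + h x) = c * pair f + pair h.
Proof.
move=> df dh; rewrite /pair mulE RintegralD ?RintegralZl //.
exact: domZ.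
Qed.

Definition gfun_fun : gfun X R := GFun dom0 domP pairP.
End gfun_fun.

Definition gfun_dirac (X : Type) (R : realType) (x0 : X) : gfun X R :=
  @GFun X R setT (fun f => f x0) I (fun _ _ _ _ _ => I) (fun _ _ _ _ _ => erefl).

(* \int a(x,z) ainv(z,y) dz = \int ainv(x,z) a(z,y) dz = delta(x - y), both
   identities being tested against the functions of [kdom a]. *)
Definition kernel_inverse (X : Type) (R : realType) (a : gkernel X R)
    (ainv : X -> X -> R) : Prop :=
  (forall y, kdom a (fun z => ainv z y)) /\
  (forall x, kdom a (fun z => ainv x z)) /\
  (forall f, kdom a f ->
     (forall y, kform a f (fun z => ainv z y) = f y) /\
     (forall x, kform a (fun z => ainv x z) f = f x)).

Section probability.
Context d (T : measurableType d) (R : realType) (P : probability T R).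

(* Point masses are listed separately since [normal_prob m 0] is not one. *)
Definition gaussian_rv (Y : T -> R) : Prop :=
  exists m : R,
    (forall B : set R, measurable B -> P (Y @^-1` B) = \d_m B) \/
    (exists2 s : R, s != 0 &
       forall B : set R, measurable B -> P (Y @^-1` B) = normal_prob m s B).

Definition jointly_gaussian (I : Type) (Y : I -> T -> R) : Prop :=
  forall (n : nat) (j : 'I_n -> I) (c : 'I_n -> R),
    gaussian_rv (fun w => \sum_(k < n) c k * Y (j k) w).

(* u has the formal density
   exp (- 1/2 \int\int u(x) a(x,y) u(y) dx dy + \int b(x) u(x) dx) / Z,
   that is, u is Gaussian with mean \int ainv(x,y) b(y) dy and covariance ainv. *)
Definition gaussian_random_function (X : Type) (u : X -> {RV P >-> R})
    (a : gkernel X R) (b : gfun X R) (ainv : X -> X -> R) : Prop :=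
  [/\ kernel_inverse a ainv,
      jointly_gaussian (fun x => u x : T -> R),
      forall x, gdom b (ainv x) /\ ('E_P[u x] = (gpair b (ainv x))%:E)%E &
      forall x y, covariance P (u x) (u y) = (ainv x y)%:E].

(* U = \int g(x) u(x) dx; the second clause is
   Cov[u(x), U] = \int ainv(x,y) g(y) dy. *)
Definition collective_variable (X : Type) (u : X -> {RV P >-> R})
    (ainv : X -> X -> R) (g : gfun X R) (U : {RV P >-> R}) : Prop :=
  {ae P, forall w, gdom g (fun x => u x w) /\
                   U w = gpair g (fun x => u x w)} /\
  (forall x, gdom g (ainv x) /\
             covariance P (u x) U = (gpair g (ainv x))%:E).

Definition rv_family (X : Type) (N : nat) (u : X -> {RV P >-> R})
    (U : 'I_N -> {RV P >-> R}) (j : X + 'I_N) : T -> R :=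
  match j with inl x => u x | inr al => U al end.

Section conditioning.
Variables (N : nat) (U : 'I_N -> {RV P >-> R}).

Definition cov_mx : 'M[R]_N :=
  \matrix_(be, al) fine (covariance P (U be) (U al)).

Definition sigma_of : set_system T :=
  <<s \bigcup_al preimage_set_system setT (U al) measurable >>.

Definition is_cond_version (O : T -> R) (h : 'cV[R]_N -> R) : Prop :=
  let hU := fun w => h (\col_al U al w) in
  [/\ continuous h,
      P.-integrable setT (EFin \o O),
      P.-integrable setT (EFin \o hU) &
      forall A, sigma_of A ->
        (\int[P]_(w in A) (O w)%:E = \int[P]_(w in A) (hU w)%:E)%E].

(* <O>_V, the value at V of the continuous version of E[O | U].  When [cov_mx]
   is invertible the law of U charges every nonempty open set, so that there is
   at most one such version; the value is 0 when there is none. *)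
Definition cond_mean (O : T -> R) (V : 'cV[R]_N) : R :=
  xget (fun=> 0) [set h | is_cond_version O h] V.

Definition cond_cov (A B : T -> R) (V : 'cV[R]_N) : R :=
  cond_mean (fun w => A w * B w) V - cond_mean A V * cond_mean B V.

End conditioning.
End probability.

Arguments gaussian_random_function {d T R} P {X} u a b ainv.
Arguments collective_variable {d T R} P {X} u ainv g U.
Arguments cov_mx {d T R} P {N} U.
Arguments is_cond_version {d T R} P {N} U O h.
Arguments cond_mean {d T R} P {N} U O V.
Arguments cond_cov {d T R} P {N} U A B V.

Definition pairings (l : nat) : {set {set {set 'I_l}}} :=
  [set S | finset.partition S [set: 'I_l] && [forall B in S, #|B| == 2%N]]%SET.

(* For a pair B = {p, q} with p < q this is F p q. *)
Definition on_pair (R : realType) (l : nat) (F : 'I_l -> 'I_l -> R)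
    (B : {set 'I_l}) : R :=
  \prod_(p in B) \prod_(q in B | (p < q)%N) F p q.

(* Main.v *)
(* Let [m_f(U)] be the linear regression of [f = u(x)] on [U = (U_1, ..., U_N)]
   and [r_f = f - m_f(U)].  The residuals and [U] are jointly Gaussian and
   uncorrelated.  Wick's theorem without conditioning follows by polarization
   from the moment recursion of the normal law; it shows that mixed moments of
   the residuals and [U] factorize, and since the moments of Gaussian variables
   determine their joint law, polynomials in the residuals are independent of
   [U].  Hence [V |-> E \prod_k (r_k + m_k(V) - c_k)] is a version of the
   conditional expectation of [\prod_k (f_k - c_k)].  It is the only continuous
   one because the law of [U] charges every open box.  Taking [c_k = m_k(V)]
   leaves [E \prod_k r_k], to which Wick's theorem applies, with covariances
   [E (r_p r_q) = Cov[f_p, f_q]_V]. *)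

Require Import Defs.
From HB Require Import structures.
From mathcomp Require Import all_boot all_order all_algebra.
From mathcomp Require Import all_classical all_reals all_analysis.
From mathcomp Require Import measurable_realfun ring lra.
Import Order.TTheory GRing.Theory Num.Theory.
Import numFieldNormedType.Exports.

Set Implicit Arguments.
Unset Strict Implicit.
Unset Printing Implicit Defensive.

Local Open Scope classical_set_scope.
Local Open Scope ring_scope.

(** * Random variables with finite moments *)

(** Joint Gaussianity is given only through the laws of single linear combinations, so every joint
    fact has to be drawn from one-dimensional ones. The device is the linear span of the centered
    variables: each member f satisfies E f^(n+1) = E f^2 * n * E f^(n-1), and mixed moments appear
    on replacing f by f + t g and comparing coefficients of t. A point mass satisfies the recursion
    with variance 0, so deterministic values of u and vanishing residuals need no separate case.

    The obstacle is the passage from factorized moments to independence, since moments do not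
    determine a law in general. What makes it possible is that exp (c |f|) is integrable for every c
    >= 0: the Taylor sums of a sine are then dominated, and indicators of half-lines are bounded
    limits of polynomials in sines. This determinacy serves twice: for the identity of integrals
    over the events of the sigma-algebra of U, and, applied once in each direction, for the
    independence of events that lets positivity of boxes be proved one coordinate at a time. *)

Section moments.
Context {R : realType} {d : measure_display} {T : measurableType d}.
Variable P : probability T R.
Implicit Types f g h : T -> R.

(** Unlike integrability of one fixed power, this condition is stable under products, so
    expectations of polynomial expressions can be expanded by linearity without leaving the
    class. *)
Definition all_moments : set (T -> R) :=
  [set f : T -> R | measurable_fun setT f /\
    forall n, P.-integrable setT (EFin \o (fun w => f w ^+ n))].

Definition mean f : R := \int[P]_w f w.

Lemma all_moments_measurable f : all_moments f -> measurable_fun setT f.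
Proof. by case. Qed.

Lemma all_moments_integrable f : all_moments f ->
  P.-integrable setT (EFin \o f).
Proof. by case=> _ /(_ 1). Qed.

Lemma all_moments_cst c : all_moments (fun=> c).
Proof.
split=> [|n]; first exact: measurable_cst.
exact: (@finite_measure_integrable_cst _ _ _ _ setT (c ^+ n)).
Qed.

Lemma all_moments_le f g : measurable_fun setT g ->
  (forall w, `|g w| <= `|f w|) -> all_moments f -> all_moments g.
Proof.
move=> mg gf [mf fn]; split=> // n.
apply: le_integrable (fn n) => //.
  by apply/measurable_EFinP; exact: measurable_funX.
by move=> w _ /=; rewrite lee_fin !normrX lerXn2r ?nnegrE.
Qed.

Let integrableM f g : all_moments f -> all_moments g ->
  P.-integrable setT (EFin \o (fun w => f w * g w)).
Proof.
move=> [mf fn] [mg gn].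
have := integrableD measurableT (fn 2) (gn 2).
apply: le_integrable => //.
  by apply/measurable_EFinP; exact: measurable_funM.
move=> w _ /=; rewrite lee_fin normrM.
rewrite [leRHS]ger0_norm ?addr_ge0 ?sqr_ge0//.
rewrite -(real_normK (num_real (f w))) -(real_normK (num_real (g w))).
have := sqr_ge0 (`|f w| - `|g w|).
have := normr_ge0 (f w); have := normr_ge0 (g w); nra.
Qed.

Lemma all_momentsX f n : all_moments f -> all_moments (fun w => f w ^+ n).
Proof.
move=> [mf fn]; split=> [|m]; first exact: measurable_funX.
by under eq_fun do rewrite -exprM; exact: fn.
Qed.

Lemma all_momentsM f g : all_moments f -> all_moments g ->
  all_moments (fun w => f w * g w).
Proof.
move=> Df Dg; split=> [|n].
  by apply: measurable_funM; exact: all_moments_measurable.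
by under eq_fun do rewrite exprMn; apply: integrableM; exact: all_momentsX.
Qed.

Lemma all_momentsD f g : all_moments f -> all_moments g ->
  all_moments (fun w => f w + g w).
Proof.
move=> Df Dg; split=> [|n].
  by apply: measurable_funD; exact: all_moments_measurable.
have -> : EFin \o (fun w => (f w + g w) ^+ n) =
    (fun w => \sum_(i <- index_enum 'I_n.+1)
       (('C(n, i)%:R * (f w ^+ (n - i) * g w ^+ i))%:E))%E.
  apply/funext => w /=; rewrite exprDn sumEFin; congr EFin.
  by apply: eq_bigr => i _; rewrite mulr_natl.
apply: integrable_sum => // i _.
apply: all_moments_integrable; apply: all_momentsM.
  exact: all_moments_cst.
by apply: all_momentsM; exact: all_momentsX.
Qed.

Lemma all_momentsZ c f : all_moments f -> all_moments (fun w => c * f w).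
Proof. by apply: all_momentsM; exact: all_moments_cst. Qed.

Lemma all_momentsN f : all_moments f -> all_moments (fun w => - f w).
Proof.
by move=> /(all_momentsZ (-1)); under eq_fun do rewrite mulN1r.
Qed.

Lemma all_momentsB f g : all_moments f -> all_moments g ->
  all_moments (fun w => f w - g w).
Proof. by move=> Df /all_momentsN; exact: all_momentsD. Qed.

Lemma all_moments_sum (I : eqType) (r : seq I) (F : I -> T -> R) :
  (forall i, i \in r -> all_moments (F i)) ->
  all_moments (fun w => \sum_(i <- r) F i w).
Proof.
elim: r => [|i r IH] DF.
  by under eq_fun do rewrite big_nil; exact: all_moments_cst.
under eq_fun do rewrite big_cons.
apply: all_momentsD; first by apply: DF; rewrite mem_head.
by apply: IH => j jr; apply: DF; rewrite inE jr orbT.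
Qed.

Lemma all_moments_prod (I : eqType) (r : seq I) (F : I -> T -> R) :
  (forall i, i \in r -> all_moments (F i)) ->
  all_moments (fun w => \prod_(i <- r) F i w).
Proof.
elim: r => [|i r IH] DF.
  by under eq_fun do rewrite big_nil; exact: all_moments_cst.
under eq_fun do rewrite big_cons.
apply: all_momentsM; first by apply: DF; rewrite mem_head.
by apply: IH => j jr; apply: DF; rewrite inE jr orbT.
Qed.

Lemma all_moments_indic (A : set T) : measurable A -> all_moments \1_A.
Proof.
move=> mA; apply: (all_moments_le (f := fun=> 1)).
- exact: measurable_indic.
- by move=> w; rewrite indicE normr1 ger0_norm// lern1 leq_b1.
- exact: all_moments_cst.
Qed.

Lemma all_moments_norm f : all_moments f -> all_moments (fun w => `|f w|).
Proof.
move=> Df; apply: all_moments_le (Df); last by move=> w; rewrite normr_id.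
by apply: measurableT_comp => //; exact: all_moments_measurable.
Qed.

Lemma mean_cst c : mean (fun=> c) = c.
Proof.
rewrite /mean Rintegral_cst//= (_ : fine _ = 1) ?mulr1//.
by rewrite probability_setT.
Qed.

Lemma meanD f g : all_moments f -> all_moments g ->
  mean (fun w => f w + g w) = mean f + mean g.
Proof. by move=> Df Dg; rewrite /mean RintegralD//;
  exact: all_moments_integrable. Qed.

Lemma meanZ c f : all_moments f -> mean (fun w => c * f w) = c * mean f.
Proof. by move=> Df; rewrite /mean RintegralZl//;
  exact: all_moments_integrable. Qed.

Lemma meanN f : all_moments f -> mean (fun w => - f w) = - mean f.
Proof. by move=> Df; under eq_fun do rewrite -mulN1r; rewrite meanZ// mulN1r. Qed.

Lemma meanB f g : all_moments f -> all_moments g ->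
  mean (fun w => f w - g w) = mean f - mean g.
Proof. by move=> Df Dg; rewrite meanD ?meanN//; exact: all_momentsN. Qed.

Lemma mean_sum (I : eqType) (r : seq I) (F : I -> T -> R) :
  (forall i, i \in r -> all_moments (F i)) ->
  mean (fun w => \sum_(i <- r) F i w) = \sum_(i <- r) mean (F i).
Proof.
elim: r => [|i r IH] DF.
  by under eq_fun do rewrite big_nil; rewrite big_nil mean_cst.
under eq_fun do rewrite big_cons.
have DFi : all_moments (F i) by apply: DF; rewrite mem_head.
have DFr j : j \in r -> all_moments (F j).
  by move=> jr; apply: DF; rewrite inE jr orbT.
by rewrite meanD ?IH ?big_cons//; exact: all_moments_sum.
Qed.

Lemma mean_indic (A : set T) : measurable A -> mean \1_A = fine (P A).
Proof. by move=> mA; rewrite /mean /Rintegral integral_indic// setIT. Qed.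

Lemma mean_sqr_ge0 f : 0 <= mean (fun w => f w ^+ 2).
Proof. by apply: Rintegral_ge0 => w _; exact: sqr_ge0. Qed.

(** Degenerate Cauchy-Schwarz: when f has second moment 0, E (t f + g)^2 is affine in t, and an
    affine function that stays nonnegative has slope 0. *)
Lemma mean_sqr0M f g : all_moments f -> all_moments g ->
  mean (fun w => f w ^+ 2) = 0 -> mean (fun w => f w * g w) = 0.
Proof.
move=> Df Dg f0; set b := mean _.
have Q t : 0 <= 2 * t * b + mean (fun w => g w ^+ 2).
  have -> : 2 * t * b + mean (fun w => g w ^+ 2) =
      mean (fun w => (t * f w + g w) ^+ 2).
    rewrite [RHS](_ : _ = mean (fun w => t ^+ 2 * f w ^+ 2 +
      (2 * t * (f w * g w) + g w ^+ 2))); last first.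
      by congr mean; apply/funext => w; ring.
    have Dfg := all_momentsM Df Dg.
    have Df2 := all_momentsX 2 Df; have Dg2 := all_momentsX 2 Dg.
    rewrite meanD; [|exact: all_momentsZ|].
      rewrite meanD//; last exact: all_momentsZ.
      by rewrite !meanZ// f0 mulr0 add0r.
    by apply: all_momentsD => //; exact: all_momentsZ.
  exact: mean_sqr_ge0.
(* For nonzero [b], this value of t would make the nonnegative expression equal to -1. *)
set c := mean _ in Q; have := Q (- (c + 1) / (2 * b)).
have [//|b0] := eqVneq b 0.
rewrite (_ : _ * b = - (c + 1)); last by field.
lra.
Qed.

Lemma cvg_mean (F : nat -> T -> R) f g :
  (forall n, measurable_fun setT (F n)) -> all_moments g ->
  (forall n w, `|F n w| <= g w) -> (forall w, F n w @[n --> \oo] --> f w) ->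
  mean (F n) @[n --> \oo] --> mean f.
Proof.
move=> mF Dg Fg Ff.
have mf : measurable_fun setT f.
  by apply: (measurable_fun_cvg mF) => w _; exact: Ff.
have [] := @dominated_convergence _ T R P setT measurableT
  (fun n => EFin \o F n) (EFin \o f) (EFin \o g).
- by move=> n; apply/measurable_EFinP.
- by apply/measurable_EFinP.
- by apply: aeW => w _ /=; apply: cvg_EFin; [exact: nearW|exact: Ff].
- exact: all_moments_integrable.
- by apply: aeW => w n _ /=; rewrite lee_fin.
move=> intf _ /= cvgF; apply: fine_cvg.
by rewrite fineK//; exact: integrable_fin_num.
Qed.

End moments.

(** * Moments of the normal law *)

Section normal_law.
Context {R : realType}.
Notation mu := (@lebesgue_measure R).

(** The change of variables is available for the Radon-Nikodym derivative; that derivative and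
    [normal_pdf] have the same integral over every measurable set, hence agree almost everywhere. *)
Lemma ge0_integral_normal_prob (m s : R) (f : R -> \bar R) : s != 0 ->
  measurable_fun setT f -> (forall x, 0 <= f x)%E ->
  (\int[normal_prob m s]_x f x = \int[mu]_x (f x * (normal_pdf m s x)%:E))%E.
Proof.
move=> s0 mf f0.
have dom := normal_prob_dominates m s.
rewrite -(Radon_Nikodym_SigmaFinite.change_of_variables dom f0 measurableT mf).
have fi := Radon_Nikodym_SigmaFinite.f_integrable dom.
have mp : measurable_fun setT (fun x => (normal_pdf m s x)%:E).
  by apply/measurable_EFinP; exact: measurable_normal_pdf.
apply: ae_eq_integral => //.
- by apply: emeasurable_funM => //; exact: measurable_int fi.
- exact: emeasurable_funM.
- apply: ae_eqe_mul2l; apply: integral_ae_eq => // E _ mE.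
  by rewrite -Radon_Nikodym_SigmaFinite.f_integral.
Qed.

Lemma expR_ge_Xn (x : R) n : 0 <= x -> x ^+ n <= n`!%:R * expR x.
Proof.
case: n => [|n] x0.
  by rewrite expr0 fact0 mul1r -expR0 ler_expR.
have := expR_ge1Dxn n x0; rewrite -ler_pdivrMl ?ltr0n ?fact_gt0//.
by rewrite mulrC; apply: le_trans; rewrite lerDr.
Qed.

(* Completing the square: [c |z| <= z^2 / (4 s^2) + c^2 s^2]. *)
Lemma normal_pdf_expR_le (m s c : R) : s != 0 -> 0 <= c ->
  {C : R | 0 <= C & forall x,
    expR (c * `|x - m|) * normal_pdf m s x <=
    C * normal_pdf m (Num.sqrt 2 * s) x}.
Proof.
move=> s0 c0; set s' := Num.sqrt 2 * s.
have s'0 : s' != 0 by rewrite mulf_neq0// sqrtr_eq0 -ltNge ltr0n.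
have s'2 : s' ^+ 2 = 2 * s ^+ 2.
  by rewrite /s' exprMn; congr (_ * _); apply: sqr_sqrtr; exact: ler0n.
exists (expR (c ^+ 2 * s ^+ 2) * normal_peak s / normal_peak s').
  by rewrite !mulr_ge0 ?expR_ge0 ?invr_ge0 ?normal_peak_ge0.
move=> x; rewrite !normal_pdfE//.
have pk0 : normal_peak s' != 0 by rewrite gt_eqF// normal_peak_gt0.
rewrite [leRHS](_ : _ = normal_peak s *
    (expR (c ^+ 2 * s ^+ 2) * normal_fun m s' x)); last by field.
rewrite mulrCA ler_wpM2l ?normal_peak_ge0// /normal_fun -!expRD ler_expR.
have -> : (x - m) ^+ 2 = `|x - m| ^+ 2 by rewrite real_normK ?num_real.
set z := `|x - m|.
rewrite s'2 -subr_ge0.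
rewrite [leRHS](_ : _ = (z / (2 * s) - c * s) ^+ 2); last by field.
exact: sqr_ge0.
Qed.

Lemma integrable_normal_expR (m s c : R) : s != 0 -> 0 <= c ->
  mu.-integrable setT
    (fun x => (expR (c * `|x - m|) * normal_pdf m s x)%:E).
Proof.
move=> s0 c0; have [C C0 Cle] := normal_pdf_expR_le m s0 c0.
have := integrableZl measurableT C (integrable_normal_pdf m (Num.sqrt 2 * s)).
apply: le_integrable => //.
  apply/measurable_EFinP; apply: measurable_funM; last first.
    exact: measurable_normal_pdf.
  apply: measurableT_comp => //; apply: measurable_funM => //.
  by apply: measurableT_comp => //; exact: measurable_funB.
move=> x _; rewrite -EFinM /= lee_fin ger0_norm; last first.
  by rewrite mulr_ge0 ?expR_ge0 ?normal_pdf_ge0.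
rewrite [leRHS]ger0_norm; first exact: Cle.
by rewrite mulr_ge0 ?normal_pdf_ge0.
Qed.

Lemma integrable_normal_Xn (m s : R) n : s != 0 ->
  mu.-integrable setT (fun x => ((x - m) ^+ n * normal_pdf m s x)%:E).
Proof.
move=> s0.
have := integrableZl measurableT n`!%:R (integrable_normal_expR m s0 ler01).
apply: le_integrable => //.
  apply/measurable_EFinP; apply: measurable_funM; last first.
    exact: measurable_normal_pdf.
  by apply: measurable_funX; exact: measurable_funB.
move=> x _; rewrite -EFinM /= lee_fin mul1r normrM normrX.
rewrite (ger0_norm (normal_pdf_ge0 _ _ _)) [leRHS]ger0_norm; last first.
  by rewrite !mulr_ge0 ?expR_ge0 ?normal_pdf_ge0.
by rewrite mulrA ler_wpM2r ?normal_pdf_ge0// expR_ge_Xn.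
Qed.

(** The integrals over growing symmetric intervals tend to 0 by the fundamental theorem of calculus
    and to the full integral by dominated convergence. The endpoints are taken at k+1 so that no
    interval is degenerate. *)
Lemma integral_derive_eq0 (F f : R -> R) :
  (forall x : R, is_derive x (1:R) F (f x)) -> continuous f ->
  mu.-integrable setT (EFin \o f) ->
  F k%:R @[k --> \oo] --> 0 -> F (- k%:R) @[k --> \oo] --> 0 ->
  \int[mu]_x f x = 0.
Proof.
move=> dF cf fi Fy FNy.
have cF : continuous F.
  by move=> x; apply/differentiable_continuous/derivable1_diffP; case: (dF x).
have FTC k : \int[mu]_(x in `[(- k.+1%:R : R), k.+1%:R]) f x =
    F k.+1%:R - F (- k.+1%:R).
  rewrite /Rintegral (@continuous_FTC2 _ f F)//.
  - by rewrite -subr_gt0 opprK -natrD ltr0n.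
  - exact: continuous_subspaceT.
  - split=> [x _||]; first by case: (dF x).
    + exact/cvg_at_right_filter/cF.
    + exact/cvg_at_left_filter/cF.
  - by move=> x _; rewrite derive1E; exact: derive_val.
have lim1 : \int[mu]_(x in `[(- k.+1%:R : R), k.+1%:R]) f x @[k --> \oo]
    --> (0 : R).
  under eq_fun do rewrite FTC.
  have Fk : F k.+1%:R @[k --> \oo] --> (0 : R).
    by rewrite (cvg_shiftS (fun k => F k%:R)).
  have FNk : F (- k.+1%:R) @[k --> \oo] --> (0 : R).
    by rewrite (cvg_shiftS (fun k => F (- k%:R))).
  by rewrite -(subr0 (0 : R)); exact: cvgB Fk FNk.
have [] := @dominated_convergence _ _ _ mu setT measurableT
  (fun k => (EFin \o f) \_ `[(- k.+1%:R : R), k.+1%:R]) (EFin \o f)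
  (abse \o (EFin \o f)).
- move=> n; apply/(measurable_restrictT _ _).1 => //.
  by apply: measurable_funTS; exact: measurable_int fi.
- exact: measurable_int fi.
- apply: aeW => x _; apply: cvg_near_cst.
  near=> k; rewrite patchE mem_set//= in_itv/= -ler_norml.
  rewrite (@le_trans _ _ k%:R)// ?ler_nat//.
  by near: k; exact: nbhs_infty_ger.
- exact: integrable_abse.
- by apply: aeW => x n _; rewrite /= patchE; case: ifP => //; rewrite abse0.
move=> _ _ lim2; apply/esym; apply: cvg_unique lim1 _ => //.
rewrite /Rintegral; apply: fine_cvg.
under eq_fun do rewrite integral_mkcond.
by rewrite fineK//; exact: integrable_fin_num.
Unshelve. all: by end_near. Qed.

Lemma is_derive_subXn (m x : R) n : is_derive x (1 : R) (fun y : R => (y - m)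
  ^+ n) (n%:R * (x - m) ^+ n.-1).
Proof.
rewrite (_ : (fun y : R => (y - m) ^+ n) = ((id : R -> R) - cst m) ^+ n).
  apply: is_derive_eq.
  by rewrite subr0 scaler1 /= -mulr_natl.
by apply/funext => y; rewrite exprfctE.
Qed.

Lemma is_derive_normal_pdf (m s x : R) : s != 0 ->
  is_derive x (1 : R) (normal_pdf m s) (- (s ^- 2 * ((x - m) * normal_pdf m s
    x))).
Proof.
move=> s0; rewrite normal_pdfE//.
have dg : is_derive x (1 : R) (fun y : R => (- (s ^+ 2 *+ 2)^-1) * (y - m) ^+ 2) 
  (- (s ^+ 2 *+ 2)^-1 * (2 * (x - m))).
  by apply: is_deriveZ; exact: is_derive_subXn.
have de := @is_derive1_comp R expR _ x _ _ (is_derive_expR _) dg.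
pose g (y : R) := - (s ^+ 2 *+ 2)^-1 * (y - m) ^+ 2.
rewrite (_ : (fun y => _) = normal_peak s \*: (expR \o g)); last first.
  apply/funext => y; rewrite /normal_fun/= /GRing.scale /= /g.
  by congr (_ * expR _); ring.
apply: is_derive_eq.
rewrite /normal_fun /GRing.scale/= /g.
rewrite (_ : - (s ^+ 2 *+ 2)^-1 * (x - m) ^+ 2 =
  - (x - m) ^+ 2 / (s ^+ 2 *+ 2)); last by field.
by field.
Qed.

(** Integration by parts: since p' = -(x - m) p / s^2, the difference of the two sides is, up to the
    factor s^2, the integral of the derivative of (x - m)^n p, which decays at both ends. For n = 0
    the truncated exponent is harmless because of the factor n. *)
Lemma normal_moment_rec (m s : R) n : s != 0 ->
  \int[mu]_x ((x - m) ^+ n.+1 * normal_pdf m s x) =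
  s ^+ 2 * n%:R * \int[mu]_x ((x - m) ^+ n.-1 * normal_pdf m s x).
Proof.
move=> s0.
pose p := normal_pdf m s; pose F x := (x - m) ^+ n * p x.
pose f x := n%:R * ((x - m) ^+ n.-1 * p x) - s ^- 2 * ((x - m) ^+ n.+1 * p x).
have dF x : is_derive x (1 : R) F (f x).
  have dX := is_derive_subXn m x n; have dp := is_derive_normal_pdf m x s0.
  have -> : F = (fun y => (y - m) ^+ n) * p by [].
  apply: is_derive_eq; rewrite /f /GRing.scale/= (exprS (x - m)) /p.
  by field.
have cp : continuous p by exact: continuous_normal_pdf.
have cX k : continuous (fun x : R => (x - m) ^+ k * p x).
  have cS : continuous (fun x : R => (x - m) ^+ k).
    move=> x; apply/differentiable_continuous/derivable1_diffP.
    by case: (is_derive_subXn m x k).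
  by move=> x; apply: cvgM; [exact: cS|exact: cp].
have iX k : mu.-integrable setT (EFin \o (fun x => (x - m) ^+ k * p x)).
  exact: integrable_normal_Xn.
have iXZ c k : mu.-integrable setT
    (EFin \o (fun x => c * ((x - m) ^+ k * p x))).
  by have := integrableZl measurableT c (iX k).
have cf : continuous f.
  by move=> x; apply: cvgB; (apply: cvgM; [exact: cvg_cst|exact: cX]).
(* With z = |x - m|, the density is bounded even after multiplication by exp (2 z): one factor exp z
   absorbs z^n, the other gives the decay, and exp |m| converts z into |x|. *)
have [C C0 FC] : {C : R | 0 <= C & forall x, `|F x| <= C * expR (- `|x|)}.
  have [C C0 Cle] := normal_pdf_expR_le m s0 (ler0n _ 2).
  have pk := normal_peak_ge0 (Num.sqrt 2 * s).
  exists (n`!%:R * (C * normal_peak (Num.sqrt 2 * s)) * expR `|m|).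
    by rewrite !mulr_ge0 ?expR_ge0.
  move=> x; rewrite normrM normrX (ger0_norm (normal_pdf_ge0 _ _ _)).
  set z := `|x - m|.
  apply: (@le_trans _ _ (n`!%:R * (expR (2 * z) * p x) * expR (- z))).
    rewrite [leRHS](_ : _ = n`!%:R * expR z * p x); last first.
      have -> : expR z = expR (2 * z) * expR (- z).
        by rewrite -expRD; congr expR; ring.
      ring.
    by rewrite ler_wpM2r ?normal_pdf_ge0// expR_ge_Xn// /z normr_ge0.
  rewrite -!mulrA ler_wpM2l// mulrA mulrA; apply: ler_pM.
  - by rewrite mulr_ge0 ?expR_ge0 ?normal_pdf_ge0.
  - exact: expR_ge0.
  - apply: le_trans (Cle x) _; rewrite ler_wpM2l// normal_pdf_ub//.
    by rewrite mulf_neq0// sqrtr_eq0 -ltNge ltr0n.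
  - rewrite -expRD ler_expR lerNl opprD opprK addrC lerBlDr.
    by rewrite -[x in `|x|](subrK m) ler_normD.
have F0 (u : nat -> R) : (forall k, k%:R <= `|u k|) ->
    F (u k) @[k --> \oo] --> 0.
  move=> ku; apply/norm_cvg0P.
  have lim0 : C * expR (- k%:R) @[k --> \oo] --> 0.
    by rewrite -(mulr0 C); apply: cvgM; [exact: cvg_cst|exact: cvgn_expR].
  apply: squeeze_cvgr (cvg_cst 0) lim0.
  apply: nearW => k; rewrite normr_ge0/=; apply: le_trans (FC _) _.
  by rewrite ler_wpM2l// ler_expR lerN2.
have /eqP : \int[mu]_x f x = 0.
  apply: (integral_derive_eq0 dF cf).
  - have := integrableB measurableT (iXZ n%:R n.-1) (iXZ (s ^- 2) n.+1).
    by apply: eq_integrable => // x _; rewrite /= EFinB.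
  - by apply: F0 => k; rewrite ger0_norm.
  - by apply: F0 => k; rewrite normrN ger0_norm.
rewrite RintegralB// !RintegralZl// subr_eq0 => /eqP nE.
by rewrite -mulrA nE mulrA divff ?mul1r// expf_neq0.
Qed.

End normal_law.

(** * One-dimensional Gaussian laws, point masses included *)

Section gaussian_rv_moments.
Context {R : realType} {d : measure_display} {T : measurableType d}.
Variables (P : probability T R) (Y : T -> R).
Hypothesis mY : measurable_fun setT Y.
Notation mu := (@lebesgue_measure R).

Let mY' : measurable_fun setT (Y : T -> measurableTypeR R).
Proof. exact: mY. Qed.
Let mY_mixin := isMeasurableFun.Build _ _ _ _ _ mY'.
Let Yrv : {mfun T >-> measurableTypeR R} := HB.pack (Y : T ->
  measurableTypeR R) mY_mixin.

Let ge0_integral_law (nu : {measure set (measurableTypeR R) -> \bar R})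
    (f : measurableTypeR R -> \bar R) :
  (forall B, measurable B -> P (Y @^-1` B) = nu B) ->
  measurable_fun setT f -> (forall x, 0 <= f x)%E ->
  (\int[P]_w f (Y w) = \int[nu]_x f x)%E.
Proof.
move=> Ynu mf f0.
rewrite -(@ge0_integral_distribution _ _ _ _ _ _ Yrv f)//.
by apply: eq_measure_integral => B mB _; exact: Ynu.
Qed.

Let normal_integral (m s : R) (f : R -> R) : s != 0 ->
  (forall B, measurable B -> P (Y @^-1` B) = normal_prob m s B) ->
  measurable_fun setT f ->
  (\int[P]_w (f (Y w))%:E = \int[mu]_x (f x * normal_pdf m s x)%:E)%E.
Proof.
move=> s0 YN mf.
have mEf : measurable_fun setT (EFin \o f) by apply/measurable_EFinP.
rewrite integralE [RHS]integralE; congr (_ - _)%E.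
  transitivity (\int[P]_w (EFin \o f)^\+ (Y w))%E.
    by apply: eq_integral => w _; rewrite !funeposE.
  rewrite (@ge0_integral_law (normal_prob m s) _ YN (measurable_funepos mEf))//.
  rewrite ge0_integral_normal_prob//; last exact: measurable_funepos.
  apply: eq_integral => x _.
  by rewrite !funeposE/= -!EFin_max -EFinM maxr_pMl ?mul0r ?normal_pdf_ge0.
transitivity (\int[P]_w (EFin \o f)^\- (Y w))%E.
  by apply: eq_integral => w _; rewrite !funenegE.
rewrite (@ge0_integral_law (normal_prob m s) _ YN (measurable_funeneg mEf))//.
rewrite ge0_integral_normal_prob//; last exact: measurable_funeneg.
apply: eq_integral => x _; rewrite !funenegE/= -!EFin_max -EFinM.
by rewrite maxr_pMl ?mul0r ?mulNr ?normal_pdf_ge0.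
Qed.

(** Both kinds of Gaussian law are summarized by the same three facts, the only ones used
    afterwards. A point mass takes v = 0: both sides of the recursion vanish and the positivity
    clause is vacuous. *)
Lemma gaussian_rvP : gaussian_rv P Y -> exists m v : R,
  [/\ forall c, 0 <= c ->
        P.-integrable setT (EFin \o (fun w => expR (c * `|Y w - m|))),
      forall n, mean P (fun w => (Y w - m) ^+ n.+1) =
        v * n%:R * mean P (fun w => (Y w - m) ^+ n.-1) &
      v != 0 -> forall r e, 0 < e ->
        (0 < P [set w | (`|Y w - m - r| < e)%R])%E].
Proof.
have mexp c m : measurable_fun setT (fun x : R => expR (c * `|x - m|)).
  apply: measurableT_comp => //; apply: measurable_funM => //.
  by apply: measurableT_comp => //; exact: measurable_funB.
have mXn m n : measurable_fun setT (fun x : R => (x - m) ^+ n).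
  by apply: measurable_funX; exact: measurable_funB.
have expi c m : (\int[P]_w (expR (c * `|Y w - m|))%:E < +oo)%E ->
    P.-integrable setT (EFin \o (fun w => expR (c * `|Y w - m|))).
  move=> lty; apply/integrableP; split.
    by apply/measurable_EFinP; apply: (measurableT_comp (mexp c m)).
  by under eq_integral do rewrite /= ger0_norm ?expR_ge0//.
move=> [m [Ydirac|[s s0 YN]]].
  have diracE (f : R -> R) : measurable_fun setT f ->
      (\int[P]_w (f (Y w))%:E = (f m)%:E)%E.
    move=> mf; have mEf : measurable_fun setT (EFin \o f) by
      apply/measurable_EFinP.
    have -> : (\int[P]_w (f (Y w))%:E = \int[\d_(m : measurableTypeR R)]_x (f
      x)%:E)%E; last first.
      by rewrite integral_dirac// diracT mul1e.
    rewrite integralE [RHS]integralE.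
    rewrite -(@ge0_integral_law \d_(m : measurableTypeR R) _ Ydirac
      (measurable_funepos mEf))//.
    rewrite -(@ge0_integral_law \d_(m : measurableTypeR R) _ Ydirac
      (measurable_funeneg mEf))//.
    by congr (_ - _)%E; apply: eq_integral => w _; rewrite ?funeposE ?funenegE.
  exists m, 0; split; last by rewrite eqxx.
  - by move=> c _; apply: expi; rewrite (diracE _ (mexp c m)) ltry.
  - move=> n; rewrite !mul0r /mean /Rintegral (diracE _ (mXn m n.+1)).
    by rewrite subrr expr0n.
exists m, (s ^+ 2); split.
- move=> c c0; apply: expi; rewrite (normal_integral s0 YN (mexp c m)).
  exact: integrable_lty (integrable_normal_expR m s0 c0).
- move=> n; rewrite /mean /Rintegral.
  rewrite !(normal_integral s0 YN (mXn m _)).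
  exact: normal_moment_rec.
- move=> _ r e e0.
  pose B : set R := ball (m + r) e.
  have mB : measurable B by exact: measurable_ball.
  have -> : [set w | `|Y w - m - r| < e] = Y @^-1` B.
    apply/funext => w; rewrite /B/= /ball/= -normrN.
    by congr (is_true (`|_| < _)); ring.
  rewrite YN//; pose K := `|r| + e.
  have K0 : 0 <= K by rewrite addr_ge0// ltW.
  (* A lower bound for the density on the ball, where the distance to the mean is at most [K]. *)
  pose delta := normal_peak s * expR (- K ^+ 2 / (s ^+ 2 *+ 2)).
  have delta0 : 0 < delta by rewrite mulr_gt0 ?normal_peak_gt0 ?expR_gt0.
  apply: (@lt_le_trans _ _ (\int[mu]_(x in B) delta%:E)%E).
    rewrite integral_cst//= lebesgue_measure_ball ?ltW// -EFinM lte_fin.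
    by rewrite mulr_gt0// mulrn_wgt0.
  apply: ge0_le_integral => //.
  - by move=> x _; rewrite lee_fin ltW.
  - by apply/measurable_EFinP; apply: measurable_funTS;
    exact: measurable_normal_pdf.
  move=> x; rewrite /B/= /ball/= => xB.
  rewrite lee_fin normal_pdfE// ler_wpM2l ?normal_peak_ge0// /normal_fun.
  rewrite ler_expR !mulNr lerN2 ler_pM2r; last first.
    by rewrite invr_gt0 mulrn_wgt0// exprn_even_gt0.
  rewrite -(real_normK (num_real (x - m))) lerXn2r ?nnegrE//.
  have -> : x - m = r - (m + r - x) by ring.
  by apply: le_trans (ler_normB _ _) _; rewrite lerD2l ltW.
Qed.

End gaussian_rv_moments.

(** * Centered Gaussian spaces *)

Section centered_gaussian_space.
Context {R : realType} {d : measure_display} {T : measurableType d}.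
Variable P : probability T R.

(** Apart from linearity, each field concerns the law of a single member; all joint information
    enters through [cgs_lin]. Centering is contained in the recursion, whose case n = 0 reads E f =
    0. *)
Record centered_gaussian_space (K : set (T -> R)) : Prop := {
  cgs_lin : forall c f g, K f -> K g -> K (fun w => c * f w + g w) ;
  cgs_moments : forall f, K f -> all_moments P f ;
  cgs_expR : forall f c, K f -> 0 <= c ->
    all_moments P (fun w => expR (c * `|f w|)) ;
  cgs_moment_rec : forall f n, K f -> mean P (fun w => f w ^+ n.+1) =
    mean P (fun w => f w ^+ 2) * n%:R * mean P (fun w => f w ^+ n.-1) ;
  cgs_gt0 : forall f, K f -> mean P (fun w => f w ^+ 2) != 0 ->
    forall r e, 0 < e -> (0 < P [set w | (`|f w - r| < e)%R])%E }.

(** The parameters produced by [gaussian_rvP] are identified by its own recursion: n = 0 shows that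
    m is the mean, n = 1 that v is the variance. *)
Lemma gaussian_rv_centered (Y : T -> R) : measurable_fun setT Y ->
  gaussian_rv P Y -> let f w := Y w - mean P Y in
  [/\ all_moments P Y,
      forall c, 0 <= c -> all_moments P (fun w => expR (c * `|f w|)),
      forall n, mean P (fun w => f w ^+ n.+1) =
        mean P (fun w => f w ^+ 2) * n%:R * mean P (fun w => f w ^+ n.-1) &
      mean P (fun w => f w ^+ 2) != 0 ->
        forall r e, 0 < e -> (0 < P [set w | (`|f w - r| < e)%R])%E].
Proof.
move=> mY /(gaussian_rvP mY)[m [v [iexp rec pos]]].
have mYm : measurable_fun setT (fun w => Y w - m) by exact: measurable_funB.
have Dexp c : 0 <= c -> all_moments P (fun w => expR (c * `|Y w - m|)).
  move=> c0; split=> [|n].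
    apply: measurableT_comp => //; apply: measurable_funM => //.
    exact: measurableT_comp.
  have nc0 : 0 <= n%:R * c by rewrite mulr_ge0.
  apply: eq_integrable (iexp _ nc0) => // w _ /=.
  by rewrite -mulrA expRM_natl.
have DYm : all_moments P (fun w => Y w - m).
  apply: all_moments_le (Dexp _ ler01) => // w.
  rewrite mul1r [leRHS]ger0_norm ?expR_ge0//.
  by apply: le_trans (expR_ge1Dx _); rewrite lerDr.
have DY : all_moments P Y.
  have := all_momentsD DYm (all_moments_cst P m).
  by under eq_fun do rewrite subrK.
have -> : mean P Y = m.
  have := rec 0%N; rewrite mulr0 mul0r.
  under eq_fun do rewrite expr1.
  by rewrite meanB// ?mean_cst; [move/eqP; rewrite subr_eq0 => /eqP|
    exact: all_moments_cst].
move=> f; have vE : mean P (fun w => f w ^+ 2) = v.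
  by rewrite (rec 1%N) /= mean_cst !mulr1.
by split=> //; rewrite vE.
Qed.

Lemma jointly_gaussian_space (I : Type) (Y : I -> T -> R) :
  (forall i, measurable_fun setT (Y i)) -> jointly_gaussian P Y ->
  (forall i, all_moments P (Y i)) /\
  centered_gaussian_space [set f : T -> R | exists n (j : 'I_n -> I) c,
    f = fun w => \sum_(k < n) c k * (Y (j k) w - mean P (Y (j k)))].
Proof.
move=> mY gY.
have DY i : all_moments P (Y i).
  have := gY 1%N (fun=> i) (fun=> 1).
  rewrite (_ : (fun w => _) = Y i).
    by case/(gaussian_rv_centered (mY i)).
  by apply/funext => w; rewrite big_ord1 mul1r.
split=> //.
(* A combination of centered variables is the centering of the combination [L], which is Gaussian by
   hypothesis. *)
have cen n (j : 'I_n -> I) (c : 'I_n -> R) :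
    let L w := \sum_(k < n) c k * Y (j k) w in
    (fun w => \sum_(k < n) c k * (Y (j k) w - mean P (Y (j k)))) =
    (fun w => L w - mean P L) /\ measurable_fun setT L.
  move=> L; split; last first.
    by apply: measurable_sum => k; apply: measurable_funM.
  apply/funext => w; rewrite /L mean_sum; last first.
    by move=> k _; exact: all_momentsZ.
  rewrite -sumrB; apply: eq_bigr => k _.
  by rewrite mulrBr meanZ.
split.
- move=> c f g [n1 [j1 [c1 ->]]] [n2 [j2 [c2 ->]]].
  exists (n1 + n2)%N,
    (fun k => match fintype.split k with inl k1 => j1 k1 | inr k2 => j2 k2 end),
    (fun k => match fintype.split k with inl k1 => c * c1 k1 | inr k2 => c2 k2
      end).
  apply/funext => w; rewrite big_split_ord /= mulr_sumr.
  congr (_ + _); apply: eq_bigr => k _.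
    by rewrite -[lshift _ _]/(unsplit (inl k)) unsplitK mulrA.
  by rewrite -[rshift _ _]/(unsplit (inr k)) unsplitK.
- move=> f [n [j [c ->]]]; apply: all_moments_sum => k _.
  by apply: all_momentsZ; apply: all_momentsB => //; exact: all_moments_cst.
- move=> f a [n [j [c fE]]] a0; have [LE mL] := cen n j c; rewrite (etrans fE LE).
  by have [_ /(_ _ a0)] := gaussian_rv_centered mL (gY n j c).
- move=> f m [n [j [c fE]]]; have [LE mL] := cen n j c; rewrite (etrans fE LE).
  by have [_ _ rec _] := gaussian_rv_centered mL (gY n j c); exact: rec.
- move=> f [n [j [c fE]]]; have [LE mL] := cen n j c; rewrite (etrans fE LE).
  by have [_ _ _ pos] := gaussian_rv_centered mL (gY n j c); exact: pos.
Qed.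

End centered_gaussian_space.

Lemma rem_catl (J : eqType) (x : J) (s1 s2 : seq J) :
  x \in s1 -> rem x (s1 ++ s2) = rem x s1 ++ s2.
Proof.
elim: s1 => //= y s IH; rewrite inE [y == x]eq_sym.
by case: eqVneq => //= _ /IH ->.
Qed.

(** This turns identities valid for every real t into identities between coefficients; otherwise the
    difference would have more roots among 0, 1, 2, ... than its degree allows. *)
Lemma poly_horner_inj (R : numDomainType) (p q : {poly R}) :
  (forall t, p.[t] = q.[t]) -> p = q.
Proof.
move=> pq; apply/eqP; rewrite -subr_eq0; apply/negPn/negP => D0.
pose rs : seq R := [seq k%:R | k <- iota 0 (size (p - q))].
suff : (size rs < size (p - q)%R)%N by rewrite size_map size_iota ltnn.
apply: max_poly_roots => //.
  by apply/allP => t _; rewrite /root !hornerE pq subrr.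
rewrite map_inj_uniq ?iota_uniq// => m n /eqP.
by rewrite eqr_nat => /eqP.
Qed.

(** * Polarized moment recursion *)

Section isserlis.
Context {R : realType} {d : measure_display} {T : measurableType d}.
Variable P : probability T R.
Notation mean := (mean P).

(** The binomial expansion of t |-> E (W (L + t M)^n), made a formal polynomial so that its
    coefficient of t, where one factor [L] is replaced by [M], can be extracted. *)
Definition mean_poly (W L M : T -> R) n : {poly R} :=
  \sum_(k < n.+1) ('C(n, k)%:R *
    mean (fun w => W w * (L w ^+ (n - k) * M w ^+ k))) *: 'X^k.

Section mean_poly.
Variables W L M : T -> R.
Hypotheses (DW : all_moments P W) (DL : all_moments P L) (DM : all_moments P M).

Lemma horner_mean_poly n t :
  (mean_poly W L M n).[t] = mean (fun w => W w * (L w + t * M w) ^+ n).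
Proof.
have DE k : all_moments P (fun w => W w * (L w ^+ (n - k) * M w ^+ k)).
  by apply: all_momentsM => //; apply: all_momentsM; exact: all_momentsX.
transitivity (mean (fun w => \sum_(k < n.+1) ('C(n, k)%:R * t ^+ k) *
    (W w * (L w ^+ (n - k) * M w ^+ k)))).
  rewrite mean_sum; last by move=> k _; exact: all_momentsZ.
  rewrite /mean_poly horner_sum; apply: eq_bigr => k _.
  by rewrite hornerZ hornerXn meanZ// mulrAC.
congr mean; apply/funext => w; rewrite exprDn mulr_sumr.
by apply: eq_bigr => k _; rewrite exprMn -mulr_natl; ring.
Qed.

Lemma coef_mean_poly n k : (k <= n)%N -> (mean_poly W L M n)`_k =
  'C(n, k)%:R * mean (fun w => W w * (L w ^+ (n - k) * M w ^+ k)).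
Proof.
move=> kn; rewrite /mean_poly coef_sum.
rewrite (bigD1 (inord k))//= big1 ?addr0 => [|i ik].
  by rewrite coefZ coefXn inordK// eqxx mulr1.
rewrite coefZ coefXn; case: eqP => [ki|]; last by rewrite mulr0.
by case/eqP: ik; apply/val_inj; rewrite /= inordK// ltnS.
Qed.

Lemma coef0_mean_poly n :
  (mean_poly W L M n)`_0 = mean (fun w => W w * L w ^+ n).
Proof.
rewrite coef_mean_poly// bin0 mul1r subn0; congr mean.
by apply/funext => w; rewrite expr0 mulr1.
Qed.

Lemma coef1_mean_poly n : (mean_poly W L M n)`_1 =
  n%:R * mean (fun w => W w * (L w ^+ n.-1 * M w)).
Proof.
case: n => [|n]; last by rewrite coef_mean_poly// bin1 subn1.
rewrite mul0r /mean_poly big_ord1 coefZ coefXn mulr0//.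
Qed.

End mean_poly.

Variable K : set (T -> R).
Hypothesis gK : centered_gaussian_space P K.

Lemma cgs_mean0 f : K f -> mean f = 0.
Proof.
move=> Kf; have := cgs_moment_rec gK 0 Kf.
by rewrite mulr0 mul0r; under eq_fun do rewrite expr1.
Qed.

Let lin_shift f g : K f -> K g -> forall t, K (fun w => g w + t * f w).
Proof.
by move=> Kf Kg t; under eq_fun do rewrite addrC; exact: (cgs_lin gK).
Qed.

(** Polarization of the moment recursion: it is applied to g + t f at exponent n+3 and the
    coefficients of t are compared. This expresses exponent n+2 through exponent n, whence an
    induction in steps of two. *)
Lemma mean_mulXn f g n : K f -> K g ->
  mean (fun w => f w * g w ^+ n) =
  n%:R * mean (fun w => f w * g w) * mean (fun w => g w ^+ n.-1).
Proof.
move=> Kf Kg; have Df := cgs_moments gK Kf; have Dg := cgs_moments gK Kg.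
elim/ltn_ind: n => -[|[|n]] IH.
- by under eq_fun do rewrite expr0 mulr1; rewrite cgs_mean0// !mul0r.
- by rewrite mean_cst mulr1 mul1r; under eq_fun do rewrite expr1.
pose Q := mean_poly (fun=> 1) g f; have D1 := all_moments_cst P 1.
have /(congr1 (fun p : {poly R} => p`_1)) : Q n.+3 = n.+2%:R *: (Q 2 * Q n.+1).
  apply: poly_horner_inj => t.
  rewrite hornerZ hornerM !horner_mean_poly//.
  have mulE k : mean (fun w => 1 * (g w + t * f w) ^+ k) =
      mean (fun w => (g w + t * f w) ^+ k).
    by congr mean; apply/funext => w; rewrite mul1r.
  by rewrite !mulE (cgs_moment_rec gK n.+2 (lin_shift Kf Kg t)); ring.
rewrite coefZ coefM big_ord_recr/= big_ord1/=.
rewrite !coef0_mean_poly// !coef1_mean_poly//=.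
have E1 k : mean (fun w => 1 * (g w ^+ k * f w)) = mean (fun w => f w * g w ^+ k).
  by congr mean; apply/funext => w; rewrite mul1r mulrC.
have E0 k : mean (fun w => 1 * g w ^+ k) = mean (fun w => g w ^+ k).
  by congr mean; apply/funext => w; rewrite mul1r.
rewrite !E1 !E0 (IH n)//.
have -> : mean (fun w => f w * g w ^+ 1) = mean (fun w => f w * g w) by [].
have rec := cgs_moment_rec gK n Kg.
move=> E; apply: (@mulfI _ n.+3%:R); first by rewrite pnatr_eq0.
rewrite {}E rec -!natr1; ring.
Qed.

Section families.
Variables (J : eqType) (F : J -> T -> R).
Hypothesis KF : forall j, K (F j).

Lemma all_moments_cgs_prod (r : seq J) :
  all_moments P (fun w => \prod_(j <- r) F j w).
Proof. by apply: all_moments_prod => j _; exact: (cgs_moments gK). Qed.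

(* Polarization: the case of [k :: r] is the coefficient of [t] in the case of
   [r] applied to [L + t F k]. *)
Lemma isserlis_Xn f (r : seq J) L n : K f -> K L ->
  mean (fun w => f w * (\prod_(j <- r) F j w * L w ^+ n)) =
  \sum_(k <- r) mean (fun w => f w * F k w) *
    mean (fun w => \prod_(j <- rem k r) F j w * L w ^+ n) +
  n%:R * mean (fun w => f w * L w) *
    mean (fun w => \prod_(j <- r) F j w * L w ^+ n.-1).
Proof.
move=> Kf; have Df := cgs_moments gK Kf.
elim: r L n => [|x r IH] L n KL.
  rewrite big_nil add0r.
  have one m : mean (fun w => \prod_(j <- [::]) F j w * L w ^+ m) =
      mean (fun w => L w ^+ m).
    by congr mean; apply/funext => w; rewrite big_nil mul1r.
  rewrite one -mean_mulXn//; congr mean.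
  by apply/funext => w; rewrite big_nil mul1r.
have DL := cgs_moments gK KL; have Dx := cgs_moments gK (KF x).
have Dr := all_moments_cgs_prod r.
pose W := fun w => f w * \prod_(j <- r) F j w.
have DW : all_moments P W by exact: all_momentsM.
pose Q V m := mean_poly V L (F x) m.
pose prodF s w := \prod_(j <- s) F j w.
have DF s : all_moments P (prodF s) by exact: all_moments_cgs_prod.
(* The induction hypothesis is taken at exponent n+1, because extracting t lowers the exponent to n;
   the factor n+1 so produced is cancelled below. *)
have /(congr1 (fun p : {poly R} => p`_1)) : Q W n.+1 =
    \sum_(k <- r) mean (fun w => f w * F k w) *: Q (prodF (rem k r)) n.+1 +
    n.+1%:R *: (((mean (fun w => f w * L w))%:P +
      (mean (fun w => f w * F x w))%:P * 'X) * Q (prodF r) n).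
  apply: poly_horner_inj => t.
  rewrite hornerD [X in _ = X + _]horner_sum hornerZ hornerM hornerD hornerM
    !hornerC hornerX.
  rewrite !horner_mean_poly//.
  have -> : mean (fun w => W w * (L w + t * F x w) ^+ n.+1) =
      mean (fun w => f w * (prodF r w * (L w + t * F x w) ^+ n.+1)).
    by congr mean; apply/funext => w; rewrite /W mulrA.
  rewrite (IH _ n.+1 (lin_shift (KF x) KL t)); congr (_ + _).
    by apply: eq_bigr => k _; rewrite hornerZ horner_mean_poly.
  rewrite mulrA; congr (_ * _ * _).
  rewrite [mean (fun w => f w * F x w) * t]mulrC -meanZ; last exact: all_momentsM.
  rewrite -meanD; [|exact: all_momentsM|].
    by congr mean; apply/funext => w; ring.
  by apply: all_momentsZ; exact: all_momentsM.
rewrite coefD [X in _ = X + _]coef_sum coefZ coefM big_ord_recr/= big_ord1/=.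
rewrite !coefD !coefCM !coefC !coefX/= !mulr0 mulr1 addr0 add0r.
rewrite coef0_mean_poly// !coef1_mean_poly//.
move=> E; apply: (@mulfI _ n.+1%:R); first by rewrite pnatr_eq0.
have -> : mean (fun w => f w * (\prod_(j <- x :: r) F j w * L w ^+ n)) =
    mean (fun w => W w * (L w ^+ n.+1.-1 * F x w)).
  by congr mean; apply/funext => w; rewrite big_cons /W/=; ring.
have remE k : k \in r -> mean (fun w => \prod_(j <- rem k (x :: r)) F j w * L w
  ^+ n) =
    mean (fun w => prodF (rem k r) w * (L w ^+ n.+1.-1 * F x w)).
  move=> kr; congr mean; apply/funext => w; rewrite /= /prodF.
  case: eqVneq => [->|_]; last by rewrite big_cons; ring.
  by rewrite (big_rem k kr)/=; ring.
have lastE : mean (fun w => \prod_(j <- x :: r) F j w * L w ^+ n.-1) =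
    mean (fun w => prodF r w * (L w ^+ n.-1 * F x w)).
  by congr mean; apply/funext => w; rewrite big_cons /prodF; ring.
have sumE : \sum_(k <- r) (mean (fun w => f w * F k w) *:
      Q (prodF (rem k r)) n.+1)`_1 =
    n.+1%:R * \sum_(k <- r) mean (fun w => f w * F k w) *
      mean (fun w => \prod_(j <- rem k (x :: r)) F j w * L w ^+ n).
  rewrite mulr_sumr; apply: eq_big_seq => k kr.
  by rewrite coefZ coef1_mean_poly// remE//; ring.
by rewrite E sumE big_cons lastE eqxx /prodF; ring.
Qed.

(** Gaussian integration by parts: [f] is paired with each other factor in turn. It is the case n =
    0 of the previous lemma, with [f] in the place of [L]. *)
Lemma isserlis f (r : seq J) : K f ->
  mean (fun w => f w * \prod_(j <- r) F j w) =
  \sum_(k <- r) mean (fun w => f w * F k w) *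
    mean (fun w => \prod_(j <- rem k r) F j w).
Proof.
move=> Kf; have := isserlis_Xn r 0 Kf Kf; rewrite mul0r mul0r addr0.
under eq_fun do rewrite expr0 mulr1.
move=> ->; apply: eq_bigr => k _; congr (_ * mean _).
by apply/funext => w; rewrite expr0 mulr1.
Qed.

(** By [isserlis], the head of [r] is paired only with members of [r], its covariances with [s]
    being 0; two factors of [r] disappear each time. The induction is on the size, since the partner
    may stand anywhere in [r]. *)
Lemma mean_prod_uncorrelated (r s : seq J) :
  (forall j k, j \in r -> k \in s -> mean (fun w => F j w * F k w) = 0) ->
  mean (fun w => \prod_(j <- r) F j w * \prod_(k <- s) F k w) =
  mean (fun w => \prod_(j <- r) F j w) * mean (fun w => \prod_(k <- s) F k w).
Proof.
have [n] := ubnP (size r); elim: n r => // n IH [_ _|x r].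
  under eq_fun do rewrite big_nil mul1r.
  by under [in X in _ = X * _]eq_fun do rewrite big_nil; rewrite mean_cst mul1r.
rewrite ltnS /= => rn unc.
under eq_fun do rewrite big_cons -mulrA -big_cat.
rewrite isserlis// big_cat/= [X in _ + X]big1_seq ?addr0; last first.
  by move=> k /andP[_ ks]; rewrite unc ?mem_head// mul0r.
under [in RHS]eq_fun do rewrite big_cons.
rewrite isserlis// mulr_suml; apply: eq_big_seq => k kr.
rewrite -mulrA; congr (_ * _).
have -> : rem k (r ++ s) = rem k r ++ s by exact: rem_catl.
under eq_fun do rewrite big_cat.
apply: IH => [|i j ir]; last by apply: unc; rewrite inE (mem_rem ir) orbT.
by rewrite size_rem//; case: (r) kr rn => //= ? ? _ /ltnW.
Qed.

End families.

End isserlis.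

(** * Determinacy of moments *)

Section sign_approximation.
Context {R : realType}.
Implicit Types x y : R.

(** The Newton-Schulz iteration for the sign function, with fixed points -1, 0 and 1. Being
    polynomial, it stays inside any algebra of functions. *)
Definition sg_step y : R := (3 * y - y ^+ 3) / 2.

Lemma iter_sg_stepN n y : iter n sg_step (- y) = - iter n sg_step y.
Proof. by elim: n => //= n ->; rewrite /sg_step; field. Qed.

Lemma iter_sg_step_itv n y : 0 <= y <= 1 -> y <= iter n sg_step y <= 1.
Proof.
move=> /andP[y0 y1]; elim: n => [|n /andP[]]; first by rewrite lexx.
rewrite iterS /sg_step; move: (iter _ _ _) => z yz z1.
have z0 : 0 <= z by exact: le_trans yz.
(* These two products are twice [sg_step z - z] and twice [1 - sg_step z]. *)
have : 0 <= z * (1 - z) * (1 + z) by rewrite !mulr_ge0 ?subr_ge0 ?addr_ge0.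
have : 0 <= (1 - z) ^+ 2 * (2 + z) by rewrite mulr_ge0 ?sqr_ge0// addr_ge0.
by move=> h1 h2; apply/andP; split; nra.
Qed.

Lemma normr_iter_sg_step n y : `|y| <= 1 -> `|iter n sg_step y| <= 1.
Proof.
move=> y1; have [y0|y0] := leP 0 y.
  rewrite ger0_norm// in y1.
  have /andP[yz z1] := @iter_sg_step_itv n y (introT andP (conj y0 y1)).
  by rewrite ger0_norm// (le_trans y0).
rewrite ltr0_norm// in y1; rewrite -(opprK y) iter_sg_stepN normrN.
have Ny0 : 0 <= - y by rewrite oppr_ge0 ltW.
have /andP[yz z1] := @iter_sg_step_itv n (- y) (introT andP (conj Ny0 y1)).
by rewrite ger0_norm// (le_trans Ny0).
Qed.

Lemma cvg_iter_sg_step y : `|y| <= 1 -> iter n sg_step y @[n --> \oo] -->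
  Num.sg y.
Proof.
have pos z : 0 < z -> z <= 1 -> iter n sg_step z @[n --> \oo] --> (1 : R).
  (* The distance to 1 is multiplied at each step by 1 - (t + t^2)/2, at most [r] because the
     iterates t stay above the starting point z. *)
  move=> z0 z1; pose r := 1 - z / 2.
  have bnd n : 1 - r ^+ n <= iter n sg_step z <= 1.
    have /andP[_ ->] := @iter_sg_step_itv n z (introT andP (conj (ltW z0) z1)).
    rewrite andbT; elim: n => [|n IH]; first by rewrite expr0 subrr ltW.
    have := @iter_sg_step_itv n z (introT andP (conj (ltW z0) z1)).
    move: IH; rewrite iterS /sg_step; move: (iter _ _ _) => t IH /andP[zt t1].
    have r0 : 0 <= r by rewrite /r; lra.
    have t0 : 0 <= t by apply: le_trans zt; exact: ltW.
    have : (1 - t) * (1 - (t + t ^+ 2) / 2) <= r ^+ n * r.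
      apply: ler_pM; first by lra.
      - have : t ^+ 2 <= 1 by rewrite exprn_ile1.
        by lra.
      - by lra.
      - by rewrite /r; have := sqr_ge0 t; lra.
    have -> : (1 - t) * (1 - (t + t ^+ 2) / 2) =
      1 - (3 * t - t ^+ 3) / 2 by field.
    by rewrite -exprSr => h; rewrite lerBlDl -lerBlDr.
  have : 1 - r ^+ n @[n --> \oo] --> (1 : R).
    rewrite -[X in _ --> X]subr0; apply: cvgB; first exact: cvg_cst.
    by apply: cvg_expr; rewrite ger0_norm /r; lra.
  move=> lim1; apply: squeeze_cvgr lim1 (cvg_cst (1 : R)).
  exact: nearW.
move=> y1; case: (ltrgt0P y) => y0.
- by rewrite gtr0_sg//; apply: pos => //; rewrite (le_trans (ler_norm _)).
- rewrite ltr0_sg//.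
  have -> : (fun n => iter n sg_step y) = (fun n => - iter n sg_step (- y)).
    by apply/funext => n; rewrite -iter_sg_stepN opprK.
  apply: cvgN; apply: pos; first by rewrite oppr_gt0.
  by rewrite (le_trans (ler_norm _))// normrN.
- rewrite y0 sgr0.
  have E n : iter n sg_step 0 = 0 :> R.
    by elim: n => //= n ->; rewrite /sg_step; field.
  by under eq_fun do rewrite E; exact: cvg_cst.
Qed.

(** As soon as n exceeds |x|, the argument lies in (-1, 1), inside (-pi, pi), where the sine has the
    sign of its argument; the sequence is eventually constant. *)
Lemma cvg_sg_sin x : Num.sg (sin (n.+1%:R^-1 * x)) @[n --> \oo] --> Num.sg x.
Proof.
apply: cvg_near_cst; near=> n.
have xn : `|x| < n.+1%:R.
  by rewrite (@lt_le_trans _ _ n%:R)// ?ler_nat//; near: n; exact: nbhs_infty_gtr.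
have pos (z : R) : 0 < z -> `|z| < n.+1%:R -> 0 < sin (n.+1%:R^-1 * z).
  move=> z0; rewrite gtr0_norm// => zn; apply: sin_gt0_pi.
  rewrite mulr_gt0 ?invr_gt0//= (@lt_le_trans _ _ 1)//.
    by rewrite ltr_pdivrMl// mulr1.
  by apply: le_trans (pi_ge2 R); rewrite ler1n.
case: (ltrgt0P x) => x0.
- by rewrite (gtr0_sg x0) gtr0_sg// pos.
- rewrite (ltr0_sg x0) ltr0_sg// -oppr_gt0 -sinN -mulrN pos ?oppr_gt0//.
  by rewrite normrN.
- by rewrite x0 mulr0 sin0.
Unshelve. all: by end_near. Qed.

(** The bound does not depend on n and so provides the majorant for dominated convergence of the
    Taylor sums. *)
Lemma series_sin_coeff_le x n : `|series (sin_coeff x) n| <= expR `|x|.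
Proof.
apply: (@le_trans _ _ (series (exp_coeff `|x|) n)).
  rewrite /series/=; apply: le_trans (ler_norm_sum _ _ _) _.
  apply: ler_sum => k _; rewrite /sin_coeff /exp_coeff/=.
  rewrite !normrM normfV !normr_nat !normrX normrN normr1 expr1n mulr1.
  by case: odd; rewrite ?mul1r// !mul0r divr_ge0// exprn_ge0.
apply: nondecreasing_cvgn_le; last exact: is_cvg_series_exp_coeff.
by apply: nondecreasing_series => k _ _; rewrite exp_coeff_ge0.
Qed.

End sign_approximation.

Lemma cvg_normr_le {R : realType} (u : R^nat) (l C : R) :
  u @ \oo --> l -> (forall n, `|u n| <= C) -> `|l| <= C.
Proof.
move=> ul uC; have lim : `|u n| @[n --> \oo] --> `|l| by exact: cvg_norm.
rewrite -(cvg_lim _ lim)//; apply: limr_le; first by apply/cvg_ex; exists `|l|.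
exact: nearW.
Qed.

Section moment_determinacy.
Context {R : realType} {d : measure_display} {T : measurableType d}.
Variables (P : probability T R) (J : eqType) (G : J -> T -> R) (Z : T -> R).
Hypothesis DG : forall j, all_moments P (G j).
Hypothesis DexpG : forall j c, 0 <= c ->
  all_moments P (fun w => expR (c * `|G j w|)).
Hypothesis DZ : all_moments P Z.
Hypothesis Z0 : forall r : seq J,
  mean P (fun w => Z w * \prod_(j <- r) G j w) = 0.

(** Orthogonality to [Z] is required against every monomial in the [G j], which makes the class
    stable under multiplication by each [G j]. Hypothesis [Z0] says that it contains the
    constants. *)
Definition orthogonal_moments : set (T -> R) :=
  [set phi : T -> R | all_moments P phi /\ forall r : seq J,
    mean P (fun w => phi w * (Z w * \prod_(j <- r) G j w)) = 0].
Local Notation orth := orthogonal_moments.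

Let DZG (r : seq J) : all_moments P (fun w => Z w * \prod_(j <- r) G j w).
Proof. by apply: all_momentsM => //; exact: all_moments_prod. Qed.

Lemma orth_cst c : orth (fun=> c).
Proof.
split=> [|r]; first exact: all_moments_cst.
by rewrite meanZ// Z0 mulr0.
Qed.

Lemma orth_lin c f g : orth f -> orth g -> orth (fun w => c * f w + g w).
Proof.
move=> [Df f0] [Dg g0]; split=> [|r].
  by apply: all_momentsD => //; exact: all_momentsZ.
under eq_fun do rewrite mulrDl -mulrA.
rewrite meanD ?meanZ ?f0 ?g0 ?mulr0 ?addr0//; [exact: all_momentsM| |].
  by apply: all_momentsZ; exact: all_momentsM.
exact: all_momentsM.
Qed.

Lemma orthZ c f : orth f -> orth (fun w => c * f w).
Proof.
move=> /(@orth_lin c _ _)/(_ (orth_cst 0)).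
by under eq_fun do rewrite addr0.
Qed.

Lemma orth_sum (I : eqType) (r : seq I) (F : I -> T -> R) :
  (forall i, i \in r -> orth (F i)) -> orth (fun w => \sum_(i <- r) F i w).
Proof.
elim: r => [|i r IH] oF.
  by under eq_fun do rewrite big_nil; exact: orth_cst.
under eq_fun do rewrite big_cons -[F i _]mul1r.
apply: orth_lin; first by apply: oF; rewrite mem_head.
by apply: IH => j jr; apply: oF; rewrite inE jr orbT.
Qed.

Lemma orthMG f j : orth f -> orth (fun w => f w * G j w).
Proof.
move=> [Df f0]; split=> [|r]; first exact: all_momentsM.
rewrite -[RHS](f0 (j :: r)); congr mean; apply/funext => w.
by rewrite big_cons; ring.
Qed.

Lemma orthM_comb (r : seq J) (k : J -> R) c f : orth f ->
  orth (fun w => f w * (\sum_(j <- r) k j * G j w + c)).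
Proof.
move=> of_; have := orth_lin c of_
  (orth_sum (r := r) (fun j _ => orthZ (k j) (orthMG j of_))).
rewrite (_ : (fun w => _) =
  (fun w => f w * (\sum_(j <- r) k j * G j w + c)))//.
apply/funext => w; rewrite mulrDr mulr_sumr addrC [f w * c]mulrC.
by congr (_ + _); apply: eq_bigr => j _; rewrite mulrCA.
Qed.

Lemma orth_lim (F : nat -> T -> R) f g : (forall n, orth (F n)) ->
  all_moments P g -> (forall n w, `|F n w| <= g w) ->
  (forall w, F n w @[n --> \oo] --> f w) -> orth f.
Proof.
move=> oF Dg Fg Ff.
have mF n : measurable_fun setT (F n).
  by have [DF _] := oF n; exact: all_moments_measurable DF.
have Df : all_moments P f.
  apply: all_moments_le Dg => [|w].
    by apply: (measurable_fun_cvg mF) => w _; exact: Ff.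
  have g0 : 0 <= g w by exact: le_trans (Fg 0%N w).
  rewrite [leRHS]ger0_norm//.
  by apply: cvg_normr_le (Ff w) _.
split=> // r; pose zg w := Z w * \prod_(j <- r) G j w.
have lim : mean P (fun w => F n w * zg w) @[n --> \oo] -->
    mean P (fun w => f w * zg w).
  apply: (@cvg_mean _ _ _ _ _ _ (fun w => g w * `|zg w|)).
  - move=> n; apply: measurable_funM => //.
    exact: all_moments_measurable (DZG r).
  - by apply: all_momentsM => //; apply: all_moments_norm; exact: DZG.
  - by move=> n w; rewrite normrM ler_wpM2r.
  - by move=> w; apply: cvgM; [exact: Ff|exact: cvg_cst].
rewrite -(cvg_lim _ lim)//; apply: lim_near_cst => //; apply: nearW => n.
by have [_ ->] := oF n.
Qed.

(** Each Taylor sum is a polynomial in [G j], and all are dominated by |f| exp (|t| |a|) exp (|t| |G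
    j|). Here the exponential moments are indispensable: finiteness of all moments would not give a
    majorant. *)
Lemma orthM_sin f j a t : orth f -> orth (fun w => f w * sin (t * (G j w - a))).
Proof.
move=> of_; have [Df _] := of_.
pose x w := t * (G j w - a).
have ofX k : orth (fun w => f w * x w ^+ k).
  elim: k => [|k IH]; first by under eq_fun do rewrite expr0 mulr1.
  have := orth_lin (- (t * a)) IH (orthZ t (orthMG j IH)).
  rewrite (_ : (fun w => _) = (fun w => f w * x w ^+ k.+1))//.
  by apply/funext => w; rewrite exprS /x; ring.
apply: (@orth_lim (fun n w => f w * series (sin_coeff (x w)) n) _
  (fun w => `|f w| * (expR (`|t| * `|a|) * expR (`|t| * `|G j w|)))).
- move=> n; rewrite /series/=.
  have -> : (fun w => f w * \sum_(0 <= k < n) sin_coeff (x w) k) =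
      (fun w => \sum_(k <- index_iota 0 n)
        ((odd k)%:R * (-1) ^+ k.-1./2 / k`!%:R) * (f w * x w ^+ k)).
    apply/funext => w; rewrite mulr_sumr; apply: eq_bigr => k _.
    by rewrite /sin_coeff/=; ring.
  by apply: orth_sum => k _; exact: orthZ.
- apply: all_momentsM; first exact: all_moments_norm.
  by apply: all_momentsZ; exact: DexpG.
- move=> n w; rewrite normrM ler_wpM2l//.
  apply: le_trans (series_sin_coeff_le _ _) _.
  rewrite -expRD ler_expR /x normrM -mulrDr ler_wpM2l//.
  by rewrite [leRHS]addrC; exact: ler_normB.
- move=> w; apply: cvgM; first exact: cvg_cst.
  by rewrite unlock; exact: is_cvg_series_sin_coeff.
Qed.

(** [orthogonal_moments] is not evidently closed under products, but functions acting on it by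
    multiplication can be composed; they form an algebra, in which the approximation of indicators
    takes place. *)
Definition multiplier : set (T -> R) :=
  [set m : T -> R | [/\ measurable_fun setT m, exists C, forall w, `|m w| <= C &
    forall f, orth f -> orth (fun w => f w * m w)]].

Lemma multiplier_cst c : multiplier (fun=> c).
Proof.
split; [exact: measurable_cst|by exists `|c| |move=> f /(orthZ c)].
by under eq_fun do rewrite mulrC.
Qed.

Lemma multiplier_lin c m1 m2 : multiplier m1 -> multiplier m2 ->
  multiplier (fun w => c * m1 w + m2 w).
Proof.
move=> [mm1 [C1 mC1] M1] [mm2 [C2 mC2] M2]; split.
- by apply: measurable_funD => //; exact: measurable_funM.
- exists (`|c| * C1 + C2) => w; apply: le_trans (ler_normD _ _) _.
  by rewrite lerD// normrM ler_wpM2l.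
- move=> f of_; have := orth_lin c (M1 _ of_) (M2 _ of_).
  rewrite (_ : (fun w => _) = (fun w => f w * (c * m1 w + m2 w)))//.
  by apply/funext => w; ring.
Qed.

Lemma multiplierM m1 m2 : multiplier m1 -> multiplier m2 ->
  multiplier (fun w => m1 w * m2 w).
Proof.
move=> [mm1 [C1 mC1] M1] [mm2 [C2 mC2] M2]; split.
- exact: measurable_funM.
- by exists (C1 * C2) => w; rewrite normrM ler_pM.
- by move=> f of_; under eq_fun do rewrite mulrA; exact: M2 (M1 _ of_).
Qed.

Lemma multiplier_lim (m : nat -> T -> R) f C : (forall n, multiplier (m n)) ->
  (forall n w, `|m n w| <= C) -> (forall w, m n w @[n --> \oo] --> f w) ->
  multiplier f.
Proof.
move=> Mm mC mf; split.
- have mm n : measurable_fun setT (m n) by case: (Mm n).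
  by apply: (measurable_fun_cvg mm) => w _; exact: mf.
- by exists C => w; apply: cvg_normr_le (mf w) _.
- move=> g og; have [Dg _] := og.
  apply: (@orth_lim (fun n w => g w * m n w) _ (fun w => C * `|g w|)).
  + by move=> n; have [_ _] := Mm n; exact.
  + by apply: all_momentsZ; exact: all_moments_norm.
  + by move=> n w; rewrite normrM mulrC ler_wpM2r.
  + by move=> w; apply: cvgM; [exact: cvg_cst|exact: mf].
Qed.

(** Two successive bounded limits: iterating [sg_step] on a sine gives the sign of that sine, and
    letting its frequency tend to 0 gives the sign of its argument. *)
Lemma multiplier_sg j a : multiplier (fun w => Num.sg (G j w - a)).
Proof.
have Msin t : multiplier (fun w => sin (t * (G j w - a))).
  split; last by move=> f; exact: orthM_sin.
  - have msin : measurable_fun setT (sin : R -> R).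
      by apply: continuous_measurable_fun; exact: continuous_sin.
    apply: (measurableT_comp msin).
    apply: measurable_funM => //; apply: measurable_funB => //.
    exact: all_moments_measurable (DG j).
  - by exists 1 => w; exact: sin_max.
have Msg t : multiplier (fun w => Num.sg (sin (t * (G j w - a)))).
  have s1 w : `|sin (t * (G j w - a))| <= 1 by exact: sin_max.
  apply: (@multiplier_lim
    (fun n w => iter n sg_step (sin (t * (G j w - a)))) _ 1).
  - elim=> [|n IH]; first exact: Msin.
    have := multiplierM IH (multiplierM IH IH).
    move=> /(multiplier_lin (- 2^-1))/(_ (multiplierM (multiplier_cst (3 / 2))
      IH)).
    set u := (fun w => _); set v := (fun w => _); suff -> : u = v by [].
    by apply/funext => w; rewrite /u /v iterS [in RHS]/sg_step; field.
  - by move=> n w; exact: normr_iter_sg_step.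
  - by move=> w; exact: cvg_iter_sg_step.
apply: (@multiplier_lim
  (fun n w => Num.sg (sin (n.+1%:R^-1 * (G j w - a)))) _ 1) => // [n w|w].
  by rewrite normr_sg lern1 leq_b1.
exact: cvg_sg_sin.
Qed.

Definition multiplier_set : set_system T :=
  [set A | measurable A /\ multiplier \1_A].

Lemma multiplier_set_gt j a : multiplier_set [set w | a < G j w].
Proof.
have mG := all_moments_measurable (DG j).
split.
  have := mG measurableT `]a, +oo[%classic (measurable_itv _).
  rewrite setTI (_ : _ @^-1` _ = [set w | a < G j w])//.
  by apply/seteqP; split=> w /=; rewrite in_itv/= andbT.
have Ms := multiplier_sg j a.
(* On the values -1, 0, 1 of a sign s, the polynomial (s^2 + s)/2 is the indicator of s = 1. *)
have := multiplier_lin 2^-1 (multiplierM Ms Ms)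
  (multiplierM (multiplier_cst 2^-1) Ms).
rewrite (_ : (fun w => _) = \1_[set w | a < G j w])//.
apply/funext => w; rewrite indicE.
have -> : (w \in [set w | a < G j w]) = (a < G j w) by apply/idP/idP; rewrite inE.
case: (ltrgtP a (G j w)) => aG /=.
- by rewrite gtr0_sg ?subr_gt0//; field.
- by rewrite ltr0_sg ?subr_lt0//; field.
- by rewrite aG subrr sgr0; field.
Qed.

(** Stability under products handles finite unions by inclusion-exclusion, so no pi-lambda argument
    is needed; countable unions are bounded limits of the finite ones. *)
Lemma multiplier_set_sigma_algebra : sigma_algebra setT multiplier_set.
Proof.
split.
- split; first exact: measurable0.
  by rewrite indic0; exact: multiplier_cst.
- move=> A [mA MA]; rewrite setTD; split; first exact: measurableC.
  have := multiplier_lin (-1) MA (multiplier_cst 1).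
  rewrite (_ : (fun w => _) = \1_(~` A))//; apply/funext => w.
  by rewrite !indicE in_setC mulN1r; case: (w \in A);
    rewrite ?addNr ?oppr0 ?add0r.
- move=> A mA; split; first by apply: bigcup_measurable => k _; case: (mA k).
  pose B n := \big[setU/set0]_(k < n) A k.
  have MB n : multiplier \1_(B n).
    elim: n => [|n IH]; first by rewrite /B big_ord0 indic0;
      exact: multiplier_cst.
    have [_ MA] := mA n.
    have := multiplier_lin 1 IH (multiplier_lin 1 MA
      (multiplierM (multiplier_cst (-1)) (multiplierM IH MA))).
    rewrite (_ : (fun w => _) = \1_(B n.+1))//; apply/funext => w.
    rewrite /B big_ord_recr/= -/(B n) !indicE in_setU.
    by case: (w \in B n); case: (w \in A n) => /=; ring.
  apply: (@multiplier_lim (fun n => \1_(B n)) _ 1) => // [n w|w].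
    by rewrite indicE normr_nat lern1 leq_b1.
  apply: cvg_near_cst; have [[k _ Akw]|nA] := pselect ((\bigcup_n A n) w).
    rewrite indicE mem_set; last by exists k.
    exists k.+1 => // n /= kn; rewrite indicE mem_set//.
    by rewrite /B -bigcup_mkord; exists k.
  apply: nearW => n; rewrite !indicE !memNset// /B -bigcup_mkord.
  by move=> [k _ Akw]; apply: nA; exists k.
Qed.

(* The moments of [G] determine the functional [phi |-> mean (phi * Z)] on the
   sigma-algebra of [G]: bounded functions preserving orthogonality form an
   algebra closed under bounded limits, which contains [sin (t (G j - a))] by
   power series expansion, hence [Num.sg (G j - a)]. *)
Lemma orthogonal_moments_indic (b : J -> R) (A : set T) :
  <<s \bigcup_j preimage_set_system setT (fun w => G j w + b j) measurable >> A ->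
  measurable A /\ orth \1_A.
Proof.
move=> sA; suff [mA [_ _ MA]] : multiplier_set A.
  split=> //; have := MA _ (orth_cst 1).
  by under eq_fun do rewrite mul1r.
apply: sA; split; first exact: multiplier_set_sigma_algebra.
move=> _ [j _ [B mB <-]]; rewrite setTI.
have [SA0 SAC SAU] := multiplier_set_sigma_algebra.
(* These [B] form a sigma-algebra, so open rays suffice; for a ray, the shift [b j] is absorbed into
   the threshold. *)
pose SB := [set B : set R | multiplier_set ((fun w => G j w + b j) @^-1` B)].
suff : @RGenOInfty.G R `<=` SB.
  move=> rays; have sB : (@RGenOInfty.G R).-sigma.-measurable B.
    by rewrite -RGenOInfty.measurableE; exact: mB.
  apply: (sB SB); split=> //; split.
  - by rewrite /SB/= preimage_set0.
  - by move=> C SC; rewrite /SB/= setTD preimage_setC -setTD; exact: SAC.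
  - by move=> C SC; rewrite /SB/= preimage_bigcup; exact: SAU.
move=> _ [x ->]; rewrite /SB/=.
rewrite (_ : _ @^-1` _ = [set w | x - b j < G j w]);
  first exact: multiplier_set_gt.
by apply/seteqP; split=> w /=; rewrite in_itv/= andbT ltrBlDr.
Qed.

End moment_determinacy.

(** * Regression and independence *)

Section linear_regression.
Context {R : realType} {d : measure_display} {T : measurableType d}.
Variables (P : probability T R) (K : set (T -> R)).
Hypothesis gK : centered_gaussian_space P K.
Notation mean := (mean P).

Lemma cgs_sub f g : K f -> K g -> K (fun w => f w - g w).
Proof.
move=> Kf Kg; have := cgs_lin gK (-1) Kg Kf.
by under eq_fun do rewrite mulN1r addrC.
Qed.

Lemma cgs_comb N (G : 'I_N -> T -> R) (c : 'I_N -> R) f : K f ->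
  (forall j, K (G j)) -> K (fun w => \sum_j c j * G j w).
Proof.
move=> Kf KG; elim: N G c KG => [|N IH] G c KG.
  (* The empty combination is obtained as f - f, which is why some member [f] of [K] is supplied. *)
  have := cgs_sub Kf Kf.
  by under eq_fun do rewrite subrr; under [X in _ ->
    K X]eq_fun do rewrite big_ord0.
under eq_fun do rewrite big_ord_recl.
by apply: (cgs_lin gK) => //; exact: IH.
Qed.

Lemma mean_combM N (G : 'I_N -> T -> R) (c : 'I_N -> R) f :
  all_moments P f -> (forall j, all_moments P (G j)) ->
  mean (fun w => (\sum_j c j * G j w) * f w) =
  \sum_j c j * mean (fun w => G j w * f w).
Proof.
move=> Df DG; under eq_fun do rewrite mulr_suml.
rewrite mean_sum; last first.
  by move=> j _; apply: all_momentsM => //; exact: all_momentsZ.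
apply: eq_bigr => j _; rewrite -meanZ; last exact: all_momentsM.
by congr mean; apply/funext => w; rewrite mulrA.
Qed.

Definition gram N (G : 'I_N -> T -> R) : 'M[R]_N :=
  \matrix_(i, j) mean (fun w => G i w * G j w).

(** The null row vectors of the Gram matrix are the coefficients of combinations with zero second
    moment, by [mean_sqr0M]. Unlike invertibility, this form passes to subfamilies at once. *)
Lemma gram_unitmxP N (G : 'I_N -> T -> R) : (forall j, all_moments P (G j)) ->
  (forall c : 'I_N -> R, mean (fun w => (\sum_j c j * G j w) ^+ 2) = 0 ->
    forall j, c j = 0) <-> gram G \in unitmx.
Proof.
move=> DG.
have Dcomb c : all_moments P (fun w => \sum_j c j * G j w).
  by apply: all_moments_sum => j _; exact: all_momentsZ.
have vgramE (v : 'rV[R]_N) i : (v *m gram G) 0 i =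
    mean (fun w => (\sum_j v 0 j * G j w) * G i w).
  by rewrite mean_combM// mxE; apply: eq_bigr => j _; rewrite mxE.
split=> [def|inv c c0 j].
  rewrite unitmxE unitfE; apply/det0P => -[v v0 vG]; case/eqP: v0.
  apply/rowP => j; rewrite mxE; apply: def.
  under eq_fun do rewrite expr2; rewrite mean_combM// big1// => i _.
  transitivity (v 0 i * (v *m gram G) 0 i); last by rewrite vG mxE mulr0.
  by rewrite vgramE; congr (_ * mean _); apply/funext => w; rewrite mulrC.
have vG : (\row_j c j) *m gram G = 0.
  apply/rowP => i; rewrite vgramE mxE.
  under eq_fun do under eq_bigr do rewrite mxE.
  exact: mean_sqr0M.
have : (\row_j c j) = 0 by rewrite -(mulmxK inv (\row_j c j)) vG mul0mx.
by move/rowP => /(_ j); rewrite !mxE.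
Qed.

Section residual.
Variables (N : nat) (G : 'I_N -> T -> R).
Hypotheses (KG : forall j, K (G j)) (invG : gram G \in unitmx).

Definition regression_coef (f : T -> R) : 'rV[R]_N :=
  (\row_j mean (fun w => f w * G j w)) *m invmx (gram G).

Definition residual (f : T -> R) (w : T) : R :=
  f w - \sum_j regression_coef f 0 j * G j w.

Lemma cgs_residual f : K f -> K (residual f).
Proof. by move=> Kf; apply: cgs_sub => //; exact: cgs_comb Kf _. Qed.

Lemma residual_uncorrelated f j : K f ->
  mean (fun w => residual f w * G j w) = 0.
Proof.
move=> Kf; have DG k := cgs_moments gK (KG k); have Df := cgs_moments gK Kf.
under eq_fun do rewrite /residual mulrBl.
rewrite meanB; [|exact: all_momentsM|]; last first.
  apply: all_momentsM => //.
  by apply: all_moments_sum => k _; exact: all_momentsZ.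
rewrite mean_combM//.
transitivity (mean (fun w => f w * G j w) - (regression_coef f *m gram G) 0 j).
  by congr (_ - _); rewrite mxE; apply: eq_bigr => k _; rewrite !mxE.
by rewrite /regression_coef mulmxKV// mxE subrr.
Qed.

End residual.

Section uncorrelated.
Variables (J1 J2 : eqType) (F : J1 -> T -> R) (G : J2 -> T -> R).
Hypotheses (KF : forall i, K (F i)) (KG : forall j, K (G j)).
Hypothesis unc : forall i j, mean (fun w => F i w * G j w) = 0.
Variable s : seq J1.

Let Z w := \prod_(i <- s) F i w - mean (fun w => \prod_(i <- s) F i w).

Lemma mean_centered_uncorrelated (r : seq J2) :
  mean (fun w => Z w * \prod_(j <- r) G j w) = 0.
Proof.
have DF := all_moments_cgs_prod gK KF s.
have DGr := all_moments_cgs_prod gK KG.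
under eq_fun do rewrite mulrBl.
rewrite meanB; [|exact: all_momentsM|exact: all_momentsZ].
rewrite meanZ//; apply/eqP; rewrite subr_eq0; apply/eqP.
(* The two families are merged into one so that the factorization lemma applies. *)
pose H (k : J1 + J2) := match k with inl i => F i | inr j => G j end.
have KH k : K (H k) by case: k.
have := @mean_prod_uncorrelated _ _ _ _ _ gK _ H KH (map inl s) (map inr r).
under eq_fun do rewrite !big_map/=.
under [in X in _ = X * _]eq_fun do rewrite !big_map/=.
under [in X in _ = _ * X]eq_fun do rewrite !big_map/=.
by apply=> _ _ /mapP[i _ ->] /mapP[j _ ->]; exact: unc.
Qed.

(** Factorized moments are exactly the hypothesis [Z0] of the determinacy argument for the centered
    monomial [Z] in the [F i]. The shift [b] allows the sigma-algebra of the uncentered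
    variables. *)
Lemma orthogonal_uncorrelated (b : J2 -> R) (A : set T) :
  <<s \bigcup_j preimage_set_system setT (fun w => G j w + b j) measurable >> A ->
  orthogonal_moments P G Z \1_A.
Proof.
move=> sA; have DG j := cgs_moments gK (KG j).
apply: (orthogonal_moments_indic DG _ _ mean_centered_uncorrelated sA).2.
- by move=> j c c0; exact: (cgs_expR gK).
- apply: all_momentsB; last exact: all_moments_cst.
  exact: (all_moments_cgs_prod gK KF).
Qed.

End uncorrelated.

Lemma box_sigma N (h : 'I_N -> T -> R) (r : 'I_N -> R) e :
  <<s \bigcup_j preimage_set_system setT (h j) measurable >>
    [set w | forall j, `|h j w - r j| < e].
Proof.
set E := \bigcup_j _.
have -> : [set w | forall j, `|h j w - r j| < e] =
    \bigcap_(j in [set: 'I_N]) (h j @^-1` ball (r j) e).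
  apply/seteqP; split=> w /= hw j; rewrite ?/ball/=.
    by move=> _; rewrite distrC; exact: hw.
  by rewrite distrC; exact: hw.
apply: (@fin_bigcap_measurable _ (g_sigma_algebraType E)) => // j _.
apply: sub_sigma_algebra; exists j => //.
by exists (ball (r j) e); [exact: measurable_ball|rewrite setTI].
Qed.

Lemma sigma_measurable (J : Type) (h : J -> T -> R) (A : set T) :
  (forall j, measurable_fun setT (h j)) ->
  <<s \bigcup_j preimage_set_system setT (h j) measurable >> A -> measurable A.
Proof.
move=> mh; apply: smallest_sub; first exact: sigma_algebra_measurable.
by move=> _ [j _ [B mB <-]]; exact: mh.
Qed.

End linear_regression.

(** * Full support *)

Section full_support.
Context {R : realType} {d : measure_display} {T : measurableType d}.
Variables (P : probability T R) (K : set (T -> R)).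
Hypothesis gK : centered_gaussian_space P K.
Notation mean := (mean P).

(** Determinacy is used in both directions: for [G] it shows that the centered indicator of [A] is
    orthogonal to all powers of [f], and for [f], with this indicator as [Z], it reaches the event
    on [f]. *)
Lemma prob_setI_uncorrelated N (G : 'I_N -> T -> R) f A r e :
  (forall j, K (G j)) -> K f -> (forall j, mean (fun w => f w * G j w) = 0) ->
  <<s \bigcup_j preimage_set_system setT (G j) measurable >> A ->
  fine (P (A `&` [set w | `|f w - r| < e])) =
  fine (P A) * fine (P [set w | `|f w - r| < e]).
Proof.
move=> KG Kf unc; set B := [set w | _].
move=> sA; pose F (_ : 'I_1) := f.
have addr0E M (h : 'I_M -> T -> R) :
    \bigcup_j preimage_set_system setT (fun w => h j w + 0) measurable =
    \bigcup_j preimage_set_system setT (h j) measurable.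
  by apply: eq_bigcupr => j _; under eq_fun do rewrite addr0.
have KF i : K (F i) by [].
have DF s := all_moments_cgs_prod gK KF s.
have sB : <<s \bigcup_j preimage_set_system setT (F j) measurable >> B.
  have := @box_sigma _ _ _ _ F (fun=> r) e.
  rewrite (_ : [set w | _] = B)//.
  by apply/seteqP; split=> w //=; move/(_ ord0).
have mA : measurable A.
  by apply: sigma_measurable sA => j; exact: (cgs_moments gK (KG j)).1.
have mB : measurable B.
  by apply: sigma_measurable sB => j; exact: (cgs_moments gK (KF j)).1.
pose Z w : R := \1_A w - fine (P A).
have DA := all_moments_indic P mA; have DB := all_moments_indic P mB.
have DZ : all_moments P Z by apply: all_momentsB => //; exact: all_moments_cst.
have Z0 (s : seq 'I_1) : mean (fun w => Z w * \prod_(i <- s) F i w) = 0.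
  have [_ /(_ [::])] : orthogonal_moments P G (fun w =>
      \prod_(i <- s) F i w - mean (fun w => \prod_(i <- s) F i w)) \1_A.
    apply: (@orthogonal_uncorrelated _ _ _ _ _ gK _ _ F G KF KG _ s (fun=> 0))
      => //.
    by rewrite addr0E.
  set m := mean (fun w => \prod_(i <- s) F i w).
  move=> E; rewrite /Z; under eq_fun do rewrite mulrBl.
  rewrite meanB; [|exact: all_momentsM|exact: all_momentsZ].
  rewrite meanZ// -/m -mean_indic// [_ * m]mulrC -meanZ// -meanB//; last first.
  - exact: all_momentsZ.
  - exact: all_momentsM.
  rewrite -[RHS]E; congr mean; apply/funext => w; rewrite big_nil; ring.
have [_ /(_ [::])] : orthogonal_moments P F Z \1_B.
  apply: (@orthogonal_moments_indic _ _ _ P _ F Z _ _ DZ Z0 (fun=> 0) B _).2.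
  - by move=> j; exact: (cgs_moments gK).
  - by move=> j c c0; exact: (cgs_expR gK).
  - by rewrite addr0E.
move=> E; rewrite -!mean_indic//; last exact: measurableI.
apply/eqP; rewrite -subr_eq0 -meanZ// -meanB//; last 2 first.
- by rewrite indicI; exact: all_momentsM.
- exact: all_momentsZ.
rewrite -[X in _ == X]E; apply/eqP; congr mean; apply/funext => w.
by rewrite big_nil indicI /Z mean_indic//=; ring.
Qed.

(** Induction on the number of variables: the last one is its regression on the others plus a
    residual that is independent of events of the others and has nonzero variance. A small box for
    the others and a small interval for the residual together lie in the required box. *)
Lemma cgs_full_support N (G : 'I_N -> T -> R) (r : 'I_N -> R) e :
  (forall j, K (G j)) -> gram P G \in unitmx -> 0 < e ->
  (0 < P [set w | forall j, (`|G j w - r j| < e)%R])%E.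
Proof.
elim: N G r e => [|N IH] G r e KG.
  move=> _ _; rewrite (_ : [set w | _] = setT) ?probability_setT ?lte01//.
  by apply/seteqP; split=> // w _ [].
have DG j := cgs_moments gK (KG j).
move=> /(gram_unitmxP DG) def e0.
pose G' j := G (widen_ord (leqnSn N) j); pose f := G ord_max.
have KG' j : K (G' j) by exact: KG.
have Kf : K f by exact: KG.
have DG' j := DG (widen_ord (leqnSn N) j).
have widenE i : widen_ord (leqnSn N) i = lift ord_max i.
  by apply/val_inj; rewrite /= /bump leqNgt ltn_ord.
have invG' : gram P G' \in unitmx.
  apply/(gram_unitmxP DG') => c c0 j.
  pose c' (i : 'I_N.+1) := if unlift ord_max i is Some i' then c i' else 0.
  have c'E i : c' (widen_ord (leqnSn N) i) = c i.
    by rewrite /c' widenE liftK.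
  rewrite -c'E; apply: def; rewrite -[RHS]c0; congr mean; apply/funext => w.
  congr (_ ^+ 2); rewrite big_ord_recr/= {2}/c' unlift_none mul0r addr0.
  by apply: eq_bigr => i _; rewrite c'E.
pose k := regression_coef P G' f 0; pose res := residual P G' f.
have Kres : K res by exact: (cgs_residual gK).
have unc j : mean (fun w => res w * G' j w) = 0 by exact:
  (residual_uncorrelated gK).
have res0 : mean (fun w => res w ^+ 2) != 0.
  (* The residual is the combination of [G] with these coefficients; zero variance would force the
     last one, 1, to vanish. *)
  pose c' (i : 'I_N.+1) := if unlift ord_max i is Some i' then - k i' else 1.
  have c'E i : c' (widen_ord (leqnSn N) i) = - k i.
    by rewrite /c' widenE liftK.
  apply/eqP => h; have : c' ord_max = 0.
    apply: def; rewrite -[RHS]h; congr mean; apply/funext => w.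
    congr (_ ^+ 2); rewrite big_ord_recr/= {2}/c' unlift_none mul1r addrC.
    rewrite /res /residual -sumrN; congr (_ + _).
    by apply: eq_bigr => i _; rewrite c'E mulNr.
  by rewrite /c' unlift_none => /eqP; rewrite oner_eq0.
pose S := \sum_j `|k j|; have S0 : 0 <= S by exact: sumr_ge0.
(* The regression part then deviates by at most [S * e'], hence by at most e/2; the residual
   accounts for the other half. Using S + 1 keeps the denominator positive when S = 0. *)
pose e' := Num.min e (e / (2 * (S + 1))).
have e'0 : 0 < e' by rewrite lt_min e0/= divr_gt0// mulr_gt0// ltr_wpDl.
pose A := [set w | forall j, `|G' j w - r (widen_ord (leqnSn N) j)| < e'].
pose rho := r ord_max - \sum_j k j * r (widen_ord (leqnSn N) j).
pose B := [set w | `|res w - rho| < e / 2].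
have PA : (0 < P A)%E by exact: IH.
have PB : (0 < P B)%E by apply: (cgs_gt0 gK) => //; rewrite divr_gt0.
have sA := box_sigma (h := G') (fun j => r (widen_ord (leqnSn N) j)) e'.
have mA : measurable A.
  by apply: sigma_measurable sA => j; exact: (DG' j).1.
have mf h : K h -> measurable_fun setT h by move=> /(cgs_moments gK) [].
have mball h s t : K h -> measurable [set w | `|h w - s| < t].
  move=> Kh; have := box_sigma (N := 1) (h := fun=> h) (fun=> s) t.
  move=> /(sigma_measurable (fun=> mf _ Kh)).
  by rewrite (_ : [set w | _] = [set w | `|h w - s| < t])//; apply/seteqP;
    split=> w //=; move/(_ ord0).
have mB : measurable B by exact: mball.
have PAB : (0 < P (A `&` B))%E.
  rewrite -[P _]fineK ?fin_num_measure//; last exact: measurableI.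
  rewrite (prob_setI_uncorrelated _ _ KG' Kres unc sA) lte_fin.
  by rewrite mulr_gt0 ?fine_gt0 ?PA ?PB ?ltey_eq ?fin_num_measure.
apply: lt_le_trans PAB _; apply: le_measure; rewrite ?inE.
- exact: measurableI.
- have := box_sigma (h := G) r e.
  by move=> /(sigma_measurable (fun j => mf _ (KG j))).
move=> w [Aw Bw] j.
case: (unliftP ord_max j) => [j' ->|->].
  by rewrite -widenE; apply: lt_le_trans (Aw j') _; rewrite ge_min lexx.
have -> : G ord_max w - r ord_max =
    (res w - rho) + \sum_j k j * (G' j w - r (widen_ord (leqnSn N) j)).
  under [in RHS]eq_bigr do rewrite mulrBr.
  by rewrite sumrB /res /residual /rho -/k /f; ring.
apply: le_lt_trans (ler_normD _ _) _.
rewrite [ltRHS](splitr e) ltr_leD//; apply: le_trans (ler_norm_sum _ _ _) _.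
apply: (@le_trans _ _ (S * e')).
  rewrite /S mulr_suml; apply: ler_sum => i _.
  by rewrite normrM ler_wpM2l// ltW.
apply: (@le_trans _ _ ((S + 1) * (e / (2 * (S + 1))))).
  by rewrite ler_pM ?(ltW e'0) ?lerDl// ge_min lexx orbT.
have S1 : S + 1 != 0 by rewrite gt_eqF// ltr_wpDl.
by rewrite le_eqVlt; apply/orP; left; apply/eqP; field.
Qed.

End full_support.

(** * Continuous version of the conditional expectation *)

Section continuous_big.
Context {R : realType} {S : topologicalType}.

Lemma continuousBr (f g : S -> R) :
  continuous f -> continuous g -> continuous (fun v => f v - g v).
Proof. by move=> cf cg v; apply: cvgB; [exact: cf|exact: cg]. Qed.

Lemma continuousMr (f g : S -> R) :
  continuous f -> continuous g -> continuous (fun v => f v * g v).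
Proof. by move=> cf cg v; apply: cvgM; [exact: cf|exact: cg]. Qed.

Variables (I : Type) (F : I -> S -> R).
Hypothesis cF : forall i, continuous (F i).

Lemma continuous_sumr (r : seq I) : continuous (fun v => \sum_(i <- r) F i v).
Proof.
elim: r => [|i r IH]; first by under eq_fun do rewrite big_nil;
  exact: cst_continuous.
under eq_fun do rewrite big_cons.
by move=> v; apply: cvgD; [exact: cF|exact: IH].
Qed.

Lemma continuous_prodr (r : seq I) : continuous (fun v => \prod_(i <- r) F i v).
Proof.
elim: r => [|i r IH]; first by under eq_fun do rewrite big_nil;
  exact: cst_continuous.
under eq_fun do rewrite big_cons.
by move=> v; apply: cvgM; [exact: cF|exact: IH].
Qed.

End continuous_big.

Section conditional_version.
Context {R : realType} {d : measure_display} {T : measurableType d}.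
Variables (P : probability T R) (K : set (T -> R)).
Hypothesis gK : centered_gaussian_space P K.
Variables (N : nat) (U : 'I_N -> {RV P >-> R}).
Notation mean := (mean P).
Let G j w := U j w - mean (U j).
Hypotheses (KG : forall j, K (G j)) (invG : gram P G \in unitmx).

Let colU w : 'cV[R]_N := \col_j U j w.

Lemma prob_box_gt0 (r : 'cV[R]_N) e : 0 < e ->
  (0 < P [set w | forall j, (`|U j w - r j 0| < e)%R])%E.
Proof.
move=> /(cgs_full_support gK (fun j => r j 0 - mean (U j)) KG invG).
rewrite (_ : [set w | _] = [set w | forall j, `|U j w - r j 0| < e])//.
apply/seteqP; split=> w /= h j; have := h j; rewrite /G;
  by rewrite (_ : _ - _ - _ = U j w - r j 0)//; ring.
Qed.

Lemma integral_indic_mean (A : set T) f : measurable A -> all_moments P f ->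
  (\int[P]_(w in A) (f w)%:E = (mean (fun w => f w * \1_A w))%:E)%E.
Proof.
move=> mA Df; rewrite integral_mkcond.
have DfA : all_moments P (fun w => f w * \1_A w).
  by apply: all_momentsM => //; exact: all_moments_indic.
rewrite /mean /Rintegral fineK; last first.
  by apply: integrable_fin_num => //; exact: all_moments_integrable.
apply: eq_integral => w _; rewrite patchE indicE.
by case: (w \in A) => /=; rewrite ?mulr1 ?mulr0.
Qed.

(** If g1 exceeded g2 at v, the gap would stay above a positive constant on a box around v; the
    corresponding event belongs to [sigma_of U] and has positive probability, yet the gap integrates
    to 0 over it. *)
Lemma is_cond_version_uniq O h1 h2 :
  is_cond_version P U O h1 -> is_cond_version P U O h2 -> h1 = h2.
Proof.
have half g1 g2 v : is_cond_version P U O g1 -> is_cond_version P U O g2 ->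
    ~ g2 v < g1 v.
  move=> [c1 _ i1 E1] [c2 _ i2 E2] gv.
  pose D x := g1 x - g2 x; pose dl := D v / 2.
  have Dv0 : 0 < D v by rewrite subr_gt0.
  have dl0 : 0 < dl by rewrite divr_gt0.
  have cD : continuous D by exact: continuousBr.
  have : nbhs v (D @^-1` [set y | dl < y]).
    apply: (cD v); apply: open_nbhs_nbhs; split; first exact: open_gt.
    by rewrite /= /dl ltr_pdivrMr// mulr_natr mulr2n ltrDl.
  move=> /nbhs_ballP[e /= e0 De].
  (* Balls of the column space are taken entrywise, so this event places [colU w] in the ball just
     found. *)
  pose A := [set w | forall j, `|U j w - v j 0| < e].
  have sA : sigma_of U A.
    exact: (@box_sigma _ _ _ _ (fun j => U j) (fun j => v j 0) e).
  have mA : measurable A.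
    by apply: sigma_measurable sA => j; exact: measurable_funP.
  have DA w : A w -> dl < D (colU w).
    move=> Aw; apply: De; split=> // i j.
    by rewrite mxE ord1 /ball/= distrC; exact: Aw.
  have iA (g : T -> R) : P.-integrable setT (EFin \o g) ->
      P.-integrable A (EFin \o g).
    by apply: integrableS.
  have : (\int[P]_(w in A) (D (colU w))%:E = 0)%E.
    under eq_integral do rewrite EFinB.
    rewrite integralB//; [|exact: iA i1|exact: iA i2].
    rewrite -(E1 A sA) -(E2 A sA) subee// (E1 A sA).
    exact: integrable_fin_num (iA _ i1).
  apply/eqP; rewrite gt_eqF//.
  apply: (@lt_le_trans _ _ (\int[P]_(w in A) dl%:E)%E).
    by rewrite integral_cst// mule_gt0 ?lte_fin//; exact: prob_box_gt0.
  apply: ge0_le_integral => //.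
  - by move=> w _; rewrite lee_fin ltW.
  - exact: measurable_int (iA _ (integrableB _ i1 i2)).
  - by move=> w Aw; rewrite lee_fin ltW// DA.
move=> V1 V2; apply/funext => v; case: (ltrgtP (h1 v) (h2 v)) => //.
- by move/(half _ _ _ V2 V1).
- by move/(half _ _ _ V1 V2).
Qed.

Definition regression (f : T -> R) (v : 'cV[R]_N) : R :=
  \sum_j regression_coef P G f 0 j * (v j 0 - mean (U j)).

Lemma regressionE f w : f w = residual P G f w + regression f (colU w).
Proof.
rewrite /residual; have -> : regression f (colU w) =
    \sum_j regression_coef P G f 0 j * G j w.
  by apply: eq_bigr => j _; rewrite [colU w j 0]mxE.
by rewrite subrK.
Qed.

Lemma continuous_regression f : continuous (regression f).
Proof.
apply: continuous_sumr => j; apply: continuousMr; first exact: cst_continuous.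
by apply: continuousBr; [exact: coord_continuous|exact: cst_continuous].
Qed.

(** Separates, in a product of terms residual plus regression, the residual factors from those
    depending on [U] alone. The products run over sequences to fit the lemmas on moments. *)
Lemma prodD_subsets l (a b : 'I_l -> R) : \prod_k (a k + b k) =
  \sum_(J : {set 'I_l}) (\prod_(k <- enum J) a k) * \prod_(k <- enum (~:
    J)%SET) b k.
Proof.
rewrite bigA_distr; apply: eq_bigr => J _.
rewrite (bigID (mem J))/= !big_enum/=; congr (_ * _).
  by apply: eq_bigr => k ->.
by apply: eq_big => [k|k /negPf ->//]; rewrite finset.in_setC.
Qed.

Section product.
Variables (l : nat) (f : 'I_l -> T -> R) (c : 'I_l -> R).
Hypothesis Kf : forall k, K (f k).

Let Res k := residual P G (f k).
Let a k v := regression (f k) v - c k.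

Let KRes k : K (Res k). Proof. exact: (cgs_residual gK). Qed.

Let DG j := cgs_moments gK (KG j).

Let Da k : all_moments P (fun w => a k (colU w)).
Proof.
apply: all_momentsB; last exact: all_moments_cst.
apply: all_moments_sum => j _; apply: all_momentsZ.
by under eq_fun do rewrite [colU _ j 0]mxE; exact: DG.
Qed.

Lemma is_cond_version_prod : is_cond_version P U
  (fun w => \prod_k (f k w - c k))
  (fun v => mean (fun w => \prod_k (residual P G (f k) w + (regression (f k) v
    - c k)))).
Proof.
pose m (J : {set 'I_l}) := mean (fun w => \prod_(k <- enum J) Res k w).
have DJ (J : {set 'I_l}) : all_moments P (fun w => \prod_(k <- enum J) Res k w).
  exact: (all_moments_cgs_prod gK KRes).
have -> : (fun v => mean (fun w => \prod_k (residual P G (f k) w + (regression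
  (f k) v - c k)))) =
    (fun v => \sum_(J : {set 'I_l}) m J * \prod_(k <- enum (~: J)%SET) a k v).
  apply/funext => v; under eq_fun do rewrite prodD_subsets.
  rewrite mean_sum => [|J _]; last first.
    by apply: all_momentsM => //; exact: all_moments_cst.
  apply: eq_bigr => J _; rewrite mulrC -meanZ//; congr mean.
  by apply/funext => w; rewrite mulrC.
(* In this form the version is a polynomial in v, which gives continuity and integrability. *)
pose h v := \sum_(J : {set 'I_l}) m J * \prod_(k <- enum (~: J)%SET) a k v.
have Daprod (J : {set 'I_l}) :
    all_moments P (fun w => \prod_(k <- enum (~: J)%SET) a k (colU w)).
  by apply: all_moments_prod => k _; exact: Da.
have Dh : all_moments P (fun w => h (colU w)).
  by apply: all_moments_sum => J _; exact: all_momentsZ.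
have Df : all_moments P (fun w => \prod_k (f k w - c k)).
  apply: all_moments_prod => k _; apply: all_momentsB;
    last exact: all_moments_cst.
  exact: (cgs_moments gK).
split.
- apply: continuous_sumr => J; apply: continuousMr; first exact: cst_continuous.
  apply: continuous_prodr => k; apply: continuousBr; last exact: cst_continuous.
  exact: continuous_regression.
- exact: all_moments_integrable.
- exact: all_moments_integrable.
move=> A sA; have mA : measurable A.
  by apply: sigma_measurable sA => j; exact: measurable_funP.
have DA := all_moments_indic P mA.
rewrite !integral_indic_mean//; congr EFin; apply/eqP; rewrite -subr_eq0.
rewrite -meanB; [|exact: all_momentsM|exact: all_momentsM].
pose Z (J : {set 'I_l}) w := \prod_(k <- enum J) Res k w - m J.
have DZ J : all_moments P (Z J).
  by apply: all_momentsB => //; exact: all_moments_cst.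
(* The expansions of the product and of [h] differ only by centering the residual monomials. The
   trailing factor 1 is the empty monomial in the definition of [orthogonal_moments]. *)
have -> : (fun w => \prod_k (f k w - c k) * \1_A w - h (colU w) * \1_A w) =
    (fun w => \sum_(J : {set 'I_l})
      (\1_A w * \prod_(k <- enum (~: J)%SET) a k (colU w)) * (Z J w * 1)).
  apply/funext => w; rewrite -mulrBl.
  under eq_bigr do rewrite (regressionE (f _)) -addrA.
  rewrite prodD_subsets /h -sumrB mulr_suml; apply: eq_bigr => J _.
  by rewrite /Z; ring.
rewrite mean_sum => [|J _]; last first.
  apply: all_momentsM; first exact: all_momentsM.
  by apply: all_momentsM => //; exact: all_moments_cst.
rewrite big1// => J _.
have unc i j : mean (fun w => Res i w * G j w) = 0.
  exact: (residual_uncorrelated gK).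
have orthA : orthogonal_moments P G (Z J) \1_A.
  apply: (@orthogonal_uncorrelated _ _ _ _ _ gK _ _ Res G KRes KG unc _ (fun j
    => mean (U j))).
  rewrite (_ : \bigcup_j _ = \bigcup_j preimage_set_system setT (U j)
    measurable)//.
  by apply: eq_bigcupr => j _; rewrite /G; under eq_fun do rewrite subrK.
(* Each factor is affine in the [G j], so multiplying by it preserves orthogonality; the factors are
   attached one at a time. *)
have : orthogonal_moments P G (Z J)
    (fun w => \1_A w * \prod_(k <- enum (~: J)%SET) a k (colU w)).
  elim: (enum _) => [|k r IH].
    by under eq_fun do rewrite big_nil mulr1.
  rewrite (_ : (fun w => \1_A w * \prod_(k <- k :: r) a k (colU w)) =
    (fun w => (\1_A w * \prod_(k <- r) a k (colU w)) *
      (\sum_j regression_coef P G (f k) 0 j * G j w + - c k))).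
    apply: orthM_comb => // s.
    exact: (mean_centered_uncorrelated gK KRes KG unc).
  apply/funext => w; rewrite big_cons -mulrA [X in _ * X]mulrC;
    congr (_ * (_ * _)).
  by congr (_ - _); apply: eq_bigr => j _; rewrite [colU w j 0]mxE.
move=> [_ /(_ [::])]; under eq_fun do rewrite big_nil.
by [].
Qed.

Lemma cond_mean_prod V :
  cond_mean P U (fun w => \prod_k (f k w - c k)) V =
  mean (fun w => \prod_k (residual P G (f k) w + (regression (f k) V - c k))).
Proof.
rewrite /cond_mean; have h := is_cond_version_prod.
by case: xgetP => [g _ /(is_cond_version_uniq h) <-|/(_ _ h)].
Qed.

End product.

Lemma cond_mean_affine f c V : K f ->
  cond_mean P U (fun w => f w - c) V = regression f V - c.
Proof.
move=> Kf; have := @cond_mean_prod 1 (fun=> f) (fun=> c) (fun=> Kf) V.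
under eq_fun do rewrite big_ord1; move=> ->.
under eq_fun do rewrite big_ord1.
have Kr : K (residual P G f) by exact: (cgs_residual gK).
rewrite meanD ?mean_cst ?(cgs_mean0 gK Kr) ?add0r//; last exact: all_moments_cst.
exact: (cgs_moments gK).
Qed.

(** The case of two factors: the residuals are centered, so the shifts contribute only the product
    m1 m2, which the conditional means remove. In particular the result does not depend on [V]. *)
Lemma cond_cov_affine f1 f2 c1 c2 V : K f1 -> K f2 ->
  cond_cov P U (fun w => f1 w - c1) (fun w => f2 w - c2) V =
  mean (fun w => residual P G f1 w * residual P G f2 w).
Proof.
move=> Kf1 Kf2; rewrite /cond_cov !cond_mean_affine//.
pose F (k : 'I_2) := if k == ord0 then f1 else f2.
pose c (k : 'I_2) := if k == ord0 then c1 else c2.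
have KF k : K (F k) by rewrite /F; case: ifP.
have := @cond_mean_prod 2 F c KF V.
have prod2 (h : 'I_2 -> R) : \prod_k h k = h ord0 * h (lift ord0 ord0).
  by rewrite big_ord_recl big_ord1.
under eq_fun do rewrite prod2.
under [in X in _ = X]eq_fun do rewrite prod2.
rewrite /F /c/= => ->; set m1 := regression f1 V - c1;
  set m2 := regression f2 V - c2.
have Kr1 : K (residual P G f1) by exact: (cgs_residual gK).
have Kr2 : K (residual P G f2) by exact: (cgs_residual gK).
have D1 := cgs_moments gK Kr1; have D2 := cgs_moments gK Kr2.
set r1 := residual P G f1; set r2 := residual P G f2.
have M1 : mean r1 = 0 := cgs_mean0 gK Kr1.
have M2 : mean r2 = 0 := cgs_mean0 gK Kr2.
have -> : (fun w => (r1 w + m1) * (r2 w + m2)) =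
    (fun w => r1 w * r2 w + (m2 * r1 w + (m1 * r2 w + m1 * m2))).
  by apply/funext => w; ring.
have Dm := all_moments_cst P (m1 * m2).
have Dm2 : all_moments P (fun w => m1 * r2 w + m1 * m2).
  by apply: all_momentsD => //; exact: all_momentsZ.
rewrite meanD; [|exact: all_momentsM|]; last first.
  by apply: all_momentsD => //; exact: all_momentsZ.
rewrite (meanD (all_momentsZ m2 D1) Dm2) (meanD (all_momentsZ m1 D2) Dm).
by rewrite (meanZ m2 D1) (meanZ m1 D2) M1 M2 mean_cst !mulr0 !add0r addrK.
Qed.

End conditional_version.

(** * Sums over pairings *)

Section wick_sum.
Local Open Scope set_scope.
Context {R : realType}.
Variables (l : nat) (F : 'I_l -> 'I_l -> R).
Hypothesis FC : forall p q, F p q = F q p.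
Implicit Types (A B : {set 'I_l}) (S : {set {set 'I_l}}).

(** Subsets of positions are allowed because the recursion removes a matched pair; the full set
    gives [pairings l]. *)
Definition pairings_of A : {set {set {set 'I_l}}} :=
  [set S | finset.partition S A && [forall B in S, #|B| == 2%N]].

Definition wick_sum A : R := \sum_(S in pairings_of A) \prod_(B in S) on_pair F B.

Lemma on_pair_set2 p q : p != q -> on_pair F [set p; q] = F p q.
Proof.
move=> pq; have prod2 (h : 'I_l -> R) : \prod_(x in [set p; q]) h x = h p * h q.
  by rewrite big_setU1 ?finset.in_set1//= big_set1.
rewrite /on_pair prod2 !big_mkcondr !prod2 !ltnn mul1r mulr1.
case: ltngtP => [_|_|/val_inj pqE]; rewrite ?mulr1 ?mul1r//.
by rewrite pqE eqxx in pq.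
Qed.

(** Makes the sum empty in the odd case. *)
Lemma card_pairings_of A S : S \in pairings_of A -> ~~ odd #|A|.
Proof.
rewrite inE => /andP[partS /forall_inP S2].
rewrite (card_partition partS) (eq_bigr (fun=> 2)) => [|B /S2/eqP//].
by rewrite sum_nat_const oddM andbF.
Qed.

Lemma wick_sum0 : wick_sum finset.set0 = 1.
Proof.
rewrite /wick_sum (big_pred1 finset.set0) ?big_set0// => S.
rewrite inE partition_set0 /=; case: (S =P finset.set0) => [->|//]; rewrite /=.
by apply/forall_inP => B; rewrite finset.in_set0.
Qed.

(** The condition that the block is absent from [S] makes adding and removing it mutually inverse,
    as the reindexing of the recursion requires. *)
Lemma pairings_ofU1 A p q S : p \in A -> q \in A :\ p ->
  (S \in pairings_of (A :\: [set p; q])) =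
  ([set p; q] |: S \in pairings_of A) && ([set p; q] \notin S).
Proof.
move=> pA; rewrite !inE => /andP[qp qA].
have sub : [set p; q] \subset A by apply/fintype.subsetP => x;
  rewrite !inE => /orP[]/eqP->.
have cpq : #|[set p; q]| = 2%N by rewrite cards2 eq_sym qp.
apply/idP/idP.
  move=> /andP[partS /forall_inP S2].
  have dis : fintype.disjoint (mem [set p; q]) (mem (A :\: [set p; q])).
    rewrite -finset.setI_eq0; apply/eqP/finset.setP => x.
    by rewrite !inE andbA andbN.
  have pq0 : [set p; q] != finset.set0 by rewrite -card_gt0 cpq.
  have notin : [set p; q] \notin S.
    apply/negP => pqS; have [/eqP covS _ _] := and3P partS.
    have : p \in finset.cover S by apply/finset.bigcupP; exists [set p;
      q] => //; rewrite finset.set21.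
    by rewrite covS !inE eqxx.
  rewrite notin andbT; apply/andP; split.
    have := partitionU1 partS pq0 dis.
    rewrite (_ : [set p; q] :|: A :\: [set p; q] = A)//.
    by rewrite -[RHS](finset.setID A [set p; q]) (finset.setIidPr sub).
  apply/forall_inP => B; rewrite !inE => /orP[/eqP->|/S2//].
  by rewrite cpq.
move=> /andP[/andP[partS /forall_inP S2] notin]; apply/andP; split.
  by have := partitionD1 partS (finset.setU11 _ _); rewrite finset.setU1K.
by apply/forall_inP => B BS; apply: S2; rewrite inE BS orbT.
Qed.

(** The partner is the other element of the block of [p]. The case r = p is excluded because {p, p}
    has one element only. *)
Lemma pairings_of_partner A p S : p \in A -> S \in pairings_of A ->
  exists2 q, q \in A :\ p & forall r, ([set p; r] \in S) = (r == q).
Proof.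
move=> pA; rewrite inE => /andP[partS /forall_inP S2].
have [/eqP covS tS _] := and3P partS.
have pS : p \in finset.cover S by rewrite covS.
have BS := finset.pblock_mem pS; have pB : p \in finset.pblock S p by rewrite
  finset.mem_pblock.
have /cards2P[x [y [xy BE]]] := S2 _ BS.
have [q pq Bq] : exists2 q, p != q & finset.pblock S p = [set p; q].
  move: pB; rewrite BE !inE => /orP[]/eqP ->; first by exists y.
  by exists x; [rewrite eq_sym|rewrite finset.setUC].
exists q.
  rewrite !inE eq_sym pq -covS; apply/finset.bigcupP;
    exists (finset.pblock S p) => //.
  by rewrite Bq !inE eqxx orbT.
move=> r; apply/idP/eqP => [rS|->]; last by rewrite -Bq.
have rE := finset.def_pblock tS rS (finset.set21 p r).
have : r \in [set p; q] by rewrite -Bq rE finset.set22.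
rewrite !inE => /orP[/eqP rp|/eqP//].
by have := S2 _ rS; rewrite rp finset.setUid cards1.
Qed.

(** Pairings are sorted by the partner of [p], and its block is then removed. This is the
    combinatorial counterpart of [isserlis]. *)
Lemma wick_sum_rec A p : p \in A ->
  wick_sum A = \sum_(q in A :\ p) F p q * wick_sum (A :\: [set p; q]).
Proof.
move=> pA.
transitivity (\sum_(q in A :\ p) \sum_(S in pairings_of A | [set p; q] \in S)
    \prod_(B in S) on_pair F B).
  rewrite (exchange_big_dep (mem (pairings_of A)))/=;
    last by move=> q S _ /andP[].
  rewrite /wick_sum; apply: eq_bigr => S SA.
  have [q qA qS] := pairings_of_partner pA SA.
  rewrite (big_pred1 q)// => r; rewrite /= SA qS.
  by case: eqP => [->|_]; rewrite ?andbF ?qA.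
apply: eq_bigr => q qA; rewrite /wick_sum mulr_sumr.
have qp : p != q by move: qA; rewrite !inE eq_sym => /andP[].
rewrite (reindex_onto (fun S => [set p; q] |: S) (fun S => S :\ [set p; q]))/=.
  apply: eq_big => [S|S SA].
    rewrite pairings_ofU1// finset.setU11 andbT; congr (_ && _).
    by apply/eqP/idP => [<-|/finset.setU1K//]; rewrite !inE eqxx.
  have pqS : [set p; q] \notin S.
    by move: SA => /andP[_ /eqP <-]; rewrite !inE eqxx.
  by rewrite big_setU1// on_pair_set2.
by move=> S /andP[_ pqS]; rewrite finset.setD1K.
Qed.

End wick_sum.

(** * Wick's theorem without conditioning *)

Section wick.
Context {R : realType} {d : measure_display} {T : measurableType d}.
Variables (P : probability T R) (K : set (T -> R)).
Hypothesis gK : centered_gaussian_space P K.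
Variables (l : nat) (f : 'I_l -> T -> R).
Hypothesis Kf : forall k, K (f k).
Local Open Scope set_scope.

(** Both sides obey the same recursion: choosing p in [A], [isserlis] on the left and [wick_sum_rec]
    on the right pair it with every other position, leaving a smaller set. *)
Lemma mean_prod_wick_sum (A : {set 'I_l}) :
  mean P (fun w => \prod_(k <- enum A) f k w) =
  wick_sum (fun p q => mean P (fun w => f p w * f q w)) A.
Proof.
have [n] := ubnP #|A|; elim: n A => // n IH A An.
have [->|/finset.set0Pn[p pA]] := eqVneq A finset.set0.
  by rewrite wick_sum0 enum_set0; under eq_fun do rewrite big_nil;
    rewrite mean_cst.
have FC (p' q : 'I_l) : mean P (fun w => f p' w * f q w) =
    mean P (fun w => f q w * f p' w).
  by congr mean; apply/funext => w; rewrite mulrC.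
rewrite (wick_sum_rec FC pA).
have -> : (fun w => \prod_(k <- enum A) f k w) =
    (fun w => f p w * \prod_(k <- enum (A :\ p)) f k w).
  by apply/funext => w; rewrite !big_enum (finset.big_setD1 p).
rewrite (isserlis gK Kf)// big_enum; apply: eq_bigr => q qA.
congr (_ * _); rewrite -IH.
  congr mean; apply/funext => w; rewrite rem_filter ?enum_uniq// big_filter.
  rewrite !big_enum_cond; apply: eq_bigl => k.
  by rewrite !inE negb_or /=; case: (k == p); case: (k == q); case: (k \in A).
rewrite -ltnS; apply: leq_trans An; rewrite ltnS; apply: proper_card.
apply/properP; split; first exact: finset.subsetDl.
by exists p => //; rewrite !inE eqxx.
Qed.

End wick.

(** * Transfer to the random function and its collective variables *)

Lemma rv_family_measurable (R : realType) d (T : measurableType d)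
  (P : probability T R) (X : Type) (N : nat) (u : X -> {RV P >-> R})
  (U : 'I_N -> {RV P >-> R}) j : measurable_fun setT (rv_family u U j).
Proof. by case: j => i; exact: measurable_funP. Qed.

Lemma fine_covariance (R : realType) (d : measure_display) (T : measurableType d)
  (P : probability T R) (f g : T -> R) :
  fine (covariance P f g) = mean P (fun w => (f w - mean P f) * (g w - mean P g)).
Proof. by rewrite unlock /mean /Rintegral !expectation.unlock. Qed.

Theorem lemma3 (R : realType) (d : measure_display) (T : measurableType d)
  (P : probability T R) (X : Type)
  (u : X -> {RV P >-> R})
  (a : gkernel X R) (b : gfun X R) (ainv : X -> X -> R)
  (hu : gaussian_random_function P u a b ainv)
  (N : nat) (g : 'I_N -> gfun X R) (U : 'I_N -> {RV P >-> R})
  (hU : forall al, collective_variable P u ainv (g al) (U al))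
  (huU : jointly_gaussian P (rv_family u U))
  (hinv : cov_mx P U \in unitmx)
  (V : 'cV[R]_N)
  (l : nat) (hl : (0 < l)%N)
  (I : Type) (x : I -> X) (i : 'I_l -> I) :
  cond_mean P U
    (fun w => \prod_(k < l) (u (x (i k)) w - cond_mean P U (u (x (i k))) V)) V =
  if odd l then 0
  else \sum_(S in pairings l) \prod_(B in S)
         on_pair (fun p q => cond_cov P U (u (x (i p))) (u (x (i q))) V) B.
Proof.
have [_ gK] := jointly_gaussian_space (@rv_family_measurable _ _ _ P X N u U) huU.
set K := (X in centered_gaussian_space P X) in gK.
have Kj j : K (fun w => rv_family u U j w - mean P (rv_family u U j)).
  exists 1%N, (fun=> j), (fun=> 1); apply/funext => w.
  by rewrite big_ord1 mul1r.
pose G j w := U j w - mean P (U j).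
have KG j : K (G j) by exact: (Kj (inr j)).
have invG : gram P G \in unitmx.
  rewrite (_ : gram P G = cov_mx P U)//; apply/matrixP => be al.
  by rewrite !mxE fine_covariance.
pose f k w := u (x (i k)) w - mean P (u (x (i k))).
have Kf k : K (f k) by exact: (Kj (inl (x (i k)))).
pose m k := mean P (u (x (i k))).
(* The uncentered value is put in the form f - c with c = - m k, to which the affine lemmas
   apply. *)
have uE k : u (x (i k)) = (fun w => f k w - - m k) :> (T -> R).
  by apply/funext => w; rewrite opprK subrK.
have condE k : cond_mean P U (u (x (i k))) V = regression U (f k) V + m k.
  by rewrite uE (cond_mean_affine gK KG invG)// opprK.
have covE p q : cond_cov P U (u (x (i p))) (u (x (i q))) V =
    mean P (fun w => residual P G (f p) w * residual P G (f q) w).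
  by rewrite !uE (cond_cov_affine gK KG invG).
have -> : (fun w => \prod_(k < l) (u (x (i k)) w - cond_mean P U (u (x (i k)))
  V)) =
    (fun w => \prod_(k < l) (f k w - regression U (f k) V)).
  apply/funext => w; apply: eq_bigr => k _; rewrite condE uE; ring.
rewrite (cond_mean_prod gK KG invG)//.
under eq_fun do under eq_bigr do rewrite subrr addr0.
have KR k : K (residual P G (f k)) by exact: (cgs_residual gK KG).
(* The product is indexed by the positions of the full set, so repeated indices among the [i k] are
   still paired as distinct positions. *)
have -> : (fun w => \prod_(k < l) residual P G (f k) w) =
    (fun w => \prod_(k <- enum [set: 'I_l]%SET) residual P G (f k) w).
  by apply/funext => w; rewrite big_enum; apply: eq_bigl => k; rewrite inE.
rewrite (mean_prod_wick_sum gK KR) /wick_sum.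
case: ifP => lodd.
  rewrite big1// => S /card_pairings_of.
  by rewrite cardsT card_ord lodd.
apply: eq_bigr => S _; apply: eq_bigr => B _.
by congr on_pair; apply/funext => p; apply/funext => q; rewrite covE.
Qed.
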